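(* Let $A$ be an asymmetric fuzzy number, $\Omega\subseteq\mathbb{R}^n$ open, $k\in\mathbb{N}$, $1\le p<\infty$, and $F,G\in W^{k,p}(\Omega,\mathbb{C}_{\mathcal{F}(A)})$. All derivatives below being weak derivatives and equalities holding almost everywhere, the following properties hold. (i) For any multi-indices $\alpha,\beta$ with $|\alpha|+|\beta|\le k$, $$D^\beta(D^\alpha F)=D^\alpha(D^\beta F)=D^{\alpha+\beta}F.$$ (ii) For every multi-index $\alpha$ with $|\alpha|\le k$ and all $c_1,c_2\in\mathbb{C}$, $$D^\alpha(c_1F\oplus c_2G)=c_1D^\alpha F\oplus c_2D^\alpha G.$$
   Context: A fuzzy number is a function $A:\mathbb{R}\to[0,1]$ whose level sets $[A]_\alpha=\{x: A(x)\ge\alpha\}$ ($0<\alpha\le1$) and $[A]_0=\overline{\{x:A(x)>0\}}$ are all nonempty closed bounded intervals; sums and real multiples of fuzzy numbers are taken level-wise, and real numbers are identified with singletons. A complex fuzzy number is an expression $C+iD$ with $C,D$ fuzzy numbers. $A$ is asymmetric if for every $y\in\mathbb{R}$ there is $x_0\in\mathbb{R}$ with $A(y-x_0)\ne A(y+x_0)$. For $u,v\in\mathbb{C}$ put $u+vA:=(\mathrm{Re}\,u+(\mathrm{Re}\,v)A)+i(\mathrm{Im}\,u+(\mathrm{Im}\,v)A)$ and $\mathbb{C}_{\mathcal{F}(A)}:=\{u+vA: u,v\in\mathbb{C}\}$. For asymmetric $A$ the map $\psi(u,v)=u+vA$ is a bijection $\mathbb{C}^2\to\mathbb{C}_{\mathcal{F}(A)}$,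 and $\mathbb{C}_{\mathcal{F}(A)}$ is a two-dimensional complex vector space with operations transported by $\psi$: $(u+vA)\oplus(z+wA)=(u+z)+(v+w)A$, $\lambda(u+vA)=\lambda u+\lambda vA$. Operations on functions with values in $\mathbb{C}_{\mathcal{F}(A)}$ are pointwise. Let $m(A)$ be the midpoint of the interval $[A]_1$. The $A$-cross product is $(u+vA)\odot(z+wA)=(uz-m(A)^2vw)+(uw+zv+2m(A)vw)A$. On $\mathbb{C}_{\mathcal{F}(A)}$, $\|u+vA\|_{\tilde p}=(|u+m(A)v|^p+|v|^p)^{1/p}$. A function $F=u+vA$ with $u,v:\Omega\to\mathbb{C}$ is integrable on a set if $u$ and $v$ are, and then $\int F=\int u+(\int v)A$. $L^p(\Omega,\mathbb{C}_{\mathcal{F}(A)})$ is the set of (measurable) $F:\Omega\to\mathbb{C}_{\mathcal{F}(A)}$ with $\int_\Omega\|F(\omega)\|_{\tilde p}^p\,d\omega<\infty$ (functions equal a.e. identified); $L^1_{\mathrm{loc}}(\Omega,\mathbb{C}_{\mathcal{F}(A)})$ is the set of functions integrable on every compact subset of $\Omega$; $C_c^\infty(\Omega,\mathbb{C}_{\mathcal{F}(A)})$ is the set of infinitely differentiable functions with compact support in $\Omega$. For $\alpha\in\mathbb{N}_0^n$, $|\alpha|=\sum_i\alpha_i$, and $F,G\in L^1_{\mathrm{loc}}(\Omega,\mathbb{C}_{\mathcal{F}(A)})$, $G$ is the $\alpha^{th}$-weak partial derivative of $F$, written $G=D^\alpha F$, if for all $\Phi\in C_c^\infty(\Omega,\mathbb{C}_{\mathcal{F}(A)})$,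 $$\int_\Omega F(\omega)\odot D^\alpha\Phi(\omega)\,d\omega=(-1)^{|\alpha|}\int_\Omega G(\omega)\odot\Phi(\omega)\,d\omega$$ (it is unique a.e.). $W^{k,p}(\Omega,\mathbb{C}_{\mathcal{F}(A)})$ is the set of $F\in L^p(\Omega,\mathbb{C}_{\mathcal{F}(A)})$ having weak derivatives $D^\alpha F\in L^p(\Omega,\mathbb{C}_{\mathcal{F}(A)})$ for all $|\alpha|\le k$. *)

(* Defs.v *)
From HB Require Import structures.
From mathcomp Require Import all_boot all_order all_algebra.
From mathcomp Require Import complex.
From mathcomp Require Import all_classical all_reals all_analysis.

Set Implicit Arguments.
Unset Strict Implicit.
Unset Printing Implicit Defensive.

Import Order.TTheory GRing.Theory Num.Theory.
Import numFieldNormedType.Exports.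
Import ComplexField.

Local Open Scope classical_set_scope.
Local Open Scope ring_scope.
Local Open Scope complex_scope.

Section fuzzy.
Context {R : realType}.
Implicit Types (A B : R -> R) (r a : R).

Definition level A a : set R :=
  if a == 0 then closure [set x | 0 < A x] else [set x | a <= A x].

Definition fuzzy_number A : Prop :=
  (forall x, 0 <= A x <= 1) /\
  (forall a, 0 <= a <= 1 ->
    exists l r, l <= r /\ level A a = [set x | l <= x <= r]).

Definition asymmetric A : Prop :=
  forall y, exists x0, A (y - x0) <> A (y + x0).

(* The membership function with prescribed level sets: its value at [x] is the
   largest [a] in ]0, 1] with [x \in L a], and [0] (the supremum of the empty
   set in MathComp-Analysis) if there is none. *)
Definition of_levels (L : R -> set R) : R -> R :=
  fun x => sup [set a | 0 < a <= 1 /\ L a x].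

Definition fadd A B : R -> R :=
  of_levels (fun a => [set x + y | x in level A a & y in level B a]).

Definition fscale r A : R -> R :=
  of_levels (fun a => [set r * x | x in level A a]).

Definition fcrisp r : R -> R := \1_[set r].

Definition mid_core A : R := (inf (level A 1) + sup (level A 1)) / 2.

End fuzzy.

(* [CFuzzy C D] is the complex fuzzy number C + iD. *)
Record cfuzzy (R : realType) := CFuzzy { fRe : R -> R ; fIm : R -> R }.

Definition affine_cfuzzy (R : realType) (A : R -> R) (u v : R[i]) : cfuzzy R :=
  CFuzzy (fadd (fcrisp (complex.Re u)) (fscale (complex.Re v) A))
         (fadd (fcrisp (complex.Im u)) (fscale (complex.Im v) A)).

Definition CF (R : realType) (A : R -> R) : Type :=
  {Z : cfuzzy R | exists uv : R[i] * R[i], Z = affine_cfuzzy A uv.1 uv.2}.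

Section CF.
Context {R : realType}.
Variable A : R -> R.
Local Notation C := R[i].
Local Notation m := ((mid_core A)%:C : C).

Definition psi (u v : C) : CF A :=
  exist _ (affine_cfuzzy A u v) (ex_intro _ (u, v) erefl).

(* Some pair mapped to [Z] by [psi]; it is the only one when [A] is an
   asymmetric fuzzy number. *)
Definition coords (Z : CF A) : C * C := sval (cid (svalP Z)).
Definition ucoord (Z : CF A) : C := (coords Z).1.
Definition vcoord (Z : CF A) : C := (coords Z).2.

Definition cfzero : CF A := psi 0 0.

Definition cfadd (Z W : CF A) : CF A :=
  psi (ucoord Z + ucoord W) (vcoord Z + vcoord W).

Definition cfscale (c : C) (Z : CF A) : CF A :=
  psi (c * ucoord Z) (c * vcoord Z).

Definition cfcross (Z W : CF A) : CF A :=
  let (u, v) := (ucoord Z, vcoord Z) in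
  let (z, w) := (ucoord W, vcoord W) in
  psi (u * z - m ^+ 2 * v * w) (u * w + z * v + 2 * m * v * w).

Definition cfnorm (p : R) (Z : CF A) : R :=
  (Normc.normc (ucoord Z + m * vcoord Z) `^ p + Normc.normc (vcoord Z) `^ p)
    `^ p^-1.

End CF.

Arguments ucoord {R A} Z.
Arguments vcoord {R A} Z.
Arguments cfadd {R A} Z W.
Arguments cfscale {R A} c Z.
Arguments cfcross {R A} Z W.
Arguments cfnorm {R A} p Z.

Section lebesgue_outer.
Context {R : realType} {n : nat}.
Implicit Types (ab : 'rV[R]_n.+1 * 'rV[R]_n.+1) (X : set 'rV[R]_n.+1).
Local Open Scope ereal_scope.

(* Half-open boxes; a box is empty, of volume 0, if [ab.2 ord0 i <= ab.1 ord0 i]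
   for some [i]. *)
Definition box ab : set 'rV[R]_n.+1 :=
  [set x | forall i, (ab.1 ord0 i < x ord0 i <= ab.2 ord0 i)%R].

Definition box_volume ab : R :=
  (\prod_(i < n.+1) Num.max 0 (ab.2 ord0 i - ab.1 ord0 i))%R.

Definition lebesgue_outer X : \bar R :=
  ereal_inf [set \sum_(k <oo) (box_volume (B k))%:E
            | B in [set B : nat -> 'rV[R]_n.+1 * 'rV[R]_n.+1 |
                    X `<=` \bigcup_k box (B k)]].

Lemma box_volume_ge0 ab : 0 <= (box_volume ab)%:E.
Proof. by rewrite lee_fin; apply: prodr_ge0 => i _; rewrite le_max lexx. Qed.

Lemma lebesgue_outer_ge0 X : 0 <= lebesgue_outer X.
Proof.
apply: le_ereal_inf_tmp => _ [B _ <-].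
by apply: nneseries_ge0 => k _ _; exact: box_volume_ge0.
Qed.

Lemma lebesgue_outer0 : lebesgue_outer set0 = 0.
Proof.
apply/eqP; rewrite eq_le lebesgue_outer_ge0 andbT.
apply: ereal_inf_lbound; exists (fun=> (0%R, 0%R)); first by [].
apply: eseries0 => k _ _; congr (_%:E).
by rewrite /box_volume big_ord_recl /= mxE subrr maxxx mul0r.
Qed.

Lemma le_lebesgue_outer :
  {homo lebesgue_outer : X Y / X `<=` Y >-> X <= Y}.
Proof.
move=> X Y XY; apply/ereal_inf_le_tmp => _ [B YB <-].
by exists B => //; exact: subset_trans XY YB.
Qed.

Lemma lebesgue_outer_sigma_subadditive : sigma_subadditive lebesgue_outer.
Proof.
move=> X; have [[i ioo]|] := pselect (exists i, lebesgue_outer (X i) = +oo).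
  rewrite (eseries_pinfty _ _ ioo) ?leey// => j _.
  by rewrite -ltNye (lt_le_trans _ (lebesgue_outer_ge0 _)).
rewrite -forallNE => Xoo; apply/lee_addgt0Pr => _/posnumP[e].
rewrite (le_trans _ (epsilon_trick _ _ _))//; last first.
  by move=> j; exact: lebesgue_outer_ge0.
pose P j (B : nat -> 'rV[R]_n.+1 * 'rV[R]_n.+1) :=
  X j `<=` \bigcup_k box (B k) /\
  \sum_(k <oo) (box_volume (B k))%:E <=
    lebesgue_outer (X j) + (e%:num / (2 ^ j.+1)%:R)%:E.
have [G PG] : {G : nat -> nat -> 'rV[R]_n.+1 * 'rV[R]_n.+1 &
    forall j, P j (G j)}.
  apply: (@choice _ _ P) => j.
  have fj : lebesgue_outer (X j) \is a fin_num.
    by rewrite ge0_fin_numE ?lebesgue_outer_ge0// ltey; exact/eqP/Xoo.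
  have e0 : (0 < e%:num / (2 ^ j.+1)%:R)%R by [].
  have [_ [B XB <-] lB] := lb_ereal_inf_adherent e0 fj.
  by exists B; split => //; exact/ltW.
pose vol ij := (box_volume (uncurry G ij))%:E.
have vol0 ij : 0 <= vol ij by exact: box_volume_ge0.
apply: (@le_trans _ _ (\esum_(ij in setT) vol ij)).
  apply: ereal_inf_lbound.
  have /card_esym/ppcard_eqP[f] := card_nat2.
  exists (uncurry G \o f).
    move=> x [i _ /(PG i).1[j _ Gx]]; exists (f^-1%FUN (i, j)) => //=.
    by rewrite invK ?inE.
  rewrite -[LHS](esum_pred_image vol f xpredT) ?[fun=> _]set_true//.
  by rewrite image_eq.
rewrite (_ : esum _ _ = \sum_(i <oo) \sum_(j <oo) vol (i, j)); last first.
  pose J : nat -> set (nat * nat) := fun i => [set (i, j) | j in setT].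
  rewrite (_ : setT = \bigcup_k J k); last first.
    by rewrite predeqE => -[a b]; split => // _; exists a => //; exists b.
  rewrite esum_bigcupT /=; last 2 first.
  - apply/trivIsetP => i j _ _ ij.
    rewrite predeqE => -[a b] /=; split => //= -[] [_] _ [<-{a} _].
    by move=> [b' _] [] /esym/eqP; rewrite (negbTE ij).
  - by [].
  rewrite -(image_id [set: nat]) -fun_true esum_pred_image//; last first.
    by move=> j _; exact: esum_ge0.
  apply: eq_eseriesr => /= j _.
  rewrite -(esum_pred_image vol (pair j) predT)//=; last first.
    by move=> ? ? _ _; exact: (@can_inj _ _ _ snd).
  by congr esum; rewrite predeqE => -[a b]; split; move=> [i _ <-]; exists i.
apply: lee_nneseries => i *; last exact: (PG i).2.
by apply: nneseries_ge0 => j *; exact: (vol0 (i, j)).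
Qed.

HB.instance Definition _ := isOuterMeasure.Build R 'rV[R]_n.+1 lebesgue_outer
  lebesgue_outer0 lebesgue_outer_ge0 le_lebesgue_outer
  lebesgue_outer_sigma_subadditive.

End lebesgue_outer.

(* R^n with the sigma-algebra of Lebesgue measurable sets. *)
Definition lebesgue_space (R : realType) (n : nat) :=
  caratheodory_type (@lebesgue_outer R n : {outer_measure set _ -> \bar R}).

Definition lebesgue_rV (R : realType) (n : nat) :
    {measure set (lebesgue_space R n) -> \bar R} :=
  let mu : {outer_measure set _ -> \bar R} := @lebesgue_outer R n in
  (mu : set (caratheodory_type mu) -> \bar R).

Section analysis.
Context {R : realType} {n : nat} {A : R -> R}.
Local Notation E := 'rV[R]_n.+1.
Local Notation X := (lebesgue_space R n).
Local Notation mu := (@lebesgue_rV R n).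
Implicit Types (f : E -> R) (w : E -> R[i]) (F G Phi : E -> CF A).
Implicit Types (Omega K : set E) (alpha : 'I_n.+1 -> nat).

(* Integration, measurability and differentiation of functions with values in
   [CF A] are componentwise, through [psi] and then real and imaginary parts. *)
Definition cintegrable K w : Prop :=
  mu.-integrable K (fun x : X => (complex.Re (w x))%:E) /\
  mu.-integrable K (fun x : X => (complex.Im (w x))%:E).

Definition cintegral K w : R[i] :=
  (\int[mu]_(x in K) complex.Re (w x))%R +i*
  (\int[mu]_(x in K) complex.Im (w x))%R.

Definition cfintegrable K F : Prop :=
  cintegrable K (ucoord \o F) /\ cintegrable K (vcoord \o F).

Definition cfintegral K F : CF A :=
  psi A (cintegral K (ucoord \o F)) (cintegral K (vcoord \o F)).

Definition cmeasurable K w : Prop :=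
  measurable_fun (K : set X) (fun x : X => complex.Re (w x)) /\
  measurable_fun (K : set X) (fun x : X => complex.Im (w x)).

Definition cfmeasurable K F : Prop :=
  cmeasurable K (ucoord \o F) /\ cmeasurable K (vcoord \o F).

(* Functions on [Omega] are represented by total functions of which only the
   values on [Omega] matter. *)
Definition Lp (p : R) Omega F : Prop :=
  cfmeasurable Omega F /\
  (\int[mu]_(x in Omega) (cfnorm p (F x) `^ p)%:E < +oo)%E.

Definition L1loc Omega F : Prop :=
  forall K, compact K -> K `<=` Omega -> cfintegrable K F.

Definition cfae_eq Omega F G : Prop :=
  {ae mu, forall x : X, Omega x -> F x = G x}.

Definition partial (i : 'I_n.+1) f : E -> R := fun x => 'D_(delta_mx 0 i) f x.

Definition morder alpha : nat := (\sum_i alpha i)%N.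

Definition madd alpha (beta : 'I_n.+1 -> nat) : 'I_n.+1 -> nat :=
  fun i => (alpha i + beta i)%N.

Definition pderiv alpha f : E -> R :=
  foldr (fun i g => iter (alpha i) (partial i) g) f (enum 'I_n.+1).

Definition smooth f : Prop :=
  forall (s : seq 'I_n.+1) x, differentiable (foldr partial f s) x.

Definition csmooth w : Prop :=
  smooth (@complex.Re R \o w) /\ smooth (@complex.Im R \o w).

Definition cpderiv alpha w : E -> R[i] :=
  fun x => pderiv alpha (@complex.Re R \o w) x +i*
           pderiv alpha (@complex.Im R \o w) x.

Definition cfsmooth F : Prop :=
  csmooth (ucoord \o F) /\ csmooth (vcoord \o F).

Definition cfpderiv alpha F : E -> CF A :=
  fun x => psi A (cpderiv alpha (ucoord \o F) x)
                 (cpderiv alpha (vcoord \o F) x).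

(* Smooth functions with compact support in [Omega], extended by zero. *)
Definition test_function Omega Phi : Prop :=
  let supp := closure [set x | Phi x <> cfzero A] in
  [/\ cfsmooth Phi, compact supp & supp `<=` Omega].

(* A relation between representatives: the weak derivative is a function only up
   to equality almost everywhere on [Omega]. *)
Definition weak_deriv Omega alpha F G : Prop :=
  [/\ L1loc Omega F, L1loc Omega G &
    forall Phi, test_function Omega Phi ->
      cfintegral Omega (fun x => cfcross (F x) (cfpderiv alpha Phi x)) =
      cfscale ((-1) ^+ morder alpha)
        (cfintegral Omega (fun x => cfcross (G x) (Phi x)))].

Definition sobolev (k : nat) (p : R) Omega F : Prop :=
  Lp p Omega F /\
  forall alpha, (morder alpha <= k)%N ->
    exists2 G, Lp p Omega G & weak_deriv Omega alpha F G.

End analysis.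

(* Main.v *)
Require Import Defs.
From mathcomp Require Import all_boot all_order all_algebra.
From mathcomp Require Import complex ring lra zify.
From mathcomp Require Import all_classical all_reals all_analysis.
From mathcomp Require Import measurable_realfun.
Import Order.TTheory GRing.Theory Num.Theory.
Import numFieldNormedType.Exports.
Local Open Scope classical_set_scope.
Local Open Scope ring_scope.

Set Implicit Arguments.
Unset Strict Implicit.
Unset Printing Implicit Defensive.

(** A function with values in the numbers u + vA is handled through its two
complex coordinates. They are well defined because [A] is asymmetric: the fuzzy
number q + rA is the crisp number q when r = 0 and x |-> A ((x - q) / r)
otherwise, and an affine change of variable that fixes [A] and is not the
identity would be a point symmetry of [A], or a translation of a bounded level
set onto itself, or force all level sets of [A] to be the same singleton, which
is again symmetric ([asymmetric_affine], [coords_psi]). The coordinates of a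
cross product are fixed linear combinations of products of coordinates, and
testing against z + 0A separates the coordinates; hence a weak derivative is
exactly a coordinatewise weak derivative of complex functions ([weak_derivE]).

For complex functions, linearity is linearity of the integral, and the
composition rule is obtained by testing against D^beta z instead of z:
if g = D^alpha f and h = D^(alpha + beta) f weakly, then
  int g D^beta z = (-1)^|alpha| int f D^alpha (D^beta z)
                 = (-1)^|alpha| int f D^(alpha + beta) z = (-1)^|beta| int h z.
The middle step is Schwarz's theorem on mixed partial derivatives
([partial_comm], [pderiv_madd]). So the derivative of order alpha + beta given by
membership in the Sobolev space is also the derivative of order beta of
D^alpha F and the derivative of order alpha of D^beta F.

All the almost everywhere equalities then follow from uniqueness of the weak
derivative, i.e. from the fundamental lemma of the calculus of variations
([annihilates_ae0]): a locally integrable h with int h phi = 0 for all test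
functions phi vanishes almost everywhere. The proof uses no convolution. If h
annihilates the test functions, so does h chi for every smooth chi. The functions
x |-> exp (- 1 / (j (x_i - c))), extended by zero to x_i <= c, are smooth, bounded
by 1, and tend to the indicator of the half-space c < x_i, so by dominated
convergence h 1_B annihilates the test functions when B is a half-space. The sets
B for which multiplication by 1_B preserves annihilating functions form a
sigma-algebra, which thus contains all boxes. Since the Lebesgue outer measure is
defined by countable covers by boxes, each set S of finite measure is contained
in a set of that sigma-algebra of the same measure ([localizing_hull]). Therefore
int_S h phi = 0 for every measurable S inside an open box, where phi is a test
function positive on that box, and h vanishes almost everywhere there; countably
many rational boxes exhaust the open set. *)

(** * Coordinates on the space of complex fuzzy numbers u + vA *)

Section fuzzy_coordinates.
Context {R : realType}.
Implicit Types (A B : R -> R) (q r s x a : R).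

Lemma of_levelsE (L : R -> set R) x b : 0 <= b <= 1 ->
  (forall a, 0 < a <= 1 -> L a x <-> a <= b) -> of_levels L x = b.
Proof.
move=> /andP[b0 b1] Lb; rewrite /of_levels.
have [bE|bn0] := eqVneq b 0.
  (* No positive level is admissible, and the supremum of the empty set is 0. *)
  rewrite bE (_ : [set a | _] = set0) ?sup0// -subset0 => a [/= a01 /(Lb _ a01)].
  by move: a01 => /andP[a0 _]; rewrite bE leNgt a0.
have b01 : 0 < b <= 1 by rewrite lt_def bn0 b0 b1.
have Lbb : L b x by apply/(Lb _ b01).
apply/eqP; rewrite eq_le; apply/andP; split.
  by apply: ge_sup => [|a [a01 /(Lb _ a01)]//]; exists b.
by apply: ub_le_sup; [exists 1 => a [/andP[]]|].
Qed.

Lemma level_gt0 A a : 0 < a -> level A a = [set x | a <= A x].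
Proof. by move=> a0; rewrite /level gt_eqF. Qed.

Lemma indic1E q x : fcrisp q x = (x == q)%:R.
Proof. by rewrite /fcrisp indicE; congr (nat_of_bool _)%:R; apply/idP/eqP; rewrite inE. Qed.

(** The positive level sets of an indicator function do not depend on the level. *)
Lemma ge_nat_bool a (b : bool) : 0 < a <= 1 -> a <= b%:R :> R <-> b.
Proof. by case: b => /andP[a0 a1]; split=> //; rewrite leNgt a0. Qed.

Lemma faddE q B x : (forall y, 0 <= B y <= 1) ->
  fadd (fcrisp q) B x = B (x - q).
Proof.
move=> B01; apply: of_levelsE => // a a01; have /andP[a0 a1] := a01.
rewrite !level_gt0//=; split.
  move=> [w /=]; rewrite indic1E => /(ge_nat_bool _ a01)/eqP -> [y /= ay <-].
  by rewrite addrC addKr.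
move=> aB; exists q; first by rewrite /= indic1E eqxx.
by exists (x - q) => //; rewrite addrC subrK.
Qed.

Section scale.
Variable A : R -> R.
Hypothesis A_fuzzy : fuzzy_number A.

(** For r = 0 this would read A 0, whereas 0 * A is the crisp number 0: the two
cases are separated because [x / 0] is [0]. *)
Lemma fscaleE r x : r != 0 -> fscale r A x = A (x / r).
Proof.
move=> r0; apply: of_levelsE; first exact: A_fuzzy.1.
move=> a /andP[a0 _]; rewrite level_gt0//=; split.
  by move=> [y /= ay <-]; rewrite mulrC mulrA mulVf// mul1r.
by move=> aA; exists (x / r) => //; rewrite mulrC divfK.
Qed.

Lemma fscale0E x : fscale 0 A x = fcrisp 0 x.
Proof.
apply: of_levelsE; first by rewrite indic1E; case: eqP; rewrite ?lexx ?ler01.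
move=> a a01; have /andP[a0 a1] := a01; rewrite indic1E.
split=> [[y _ <-]|]; first by rewrite mul0r eqxx.
move/(ge_nat_bool _ a01)/eqP ->.
have [|l [r [lr Alr]]] := A_fuzzy.2 a; first by rewrite ltW.
by exists l; rewrite ?mul0r// Alr /= lexx.
Qed.

Lemma fscale01 r x : 0 <= fscale r A x <= 1.
Proof.
have [->|r0] := eqVneq r 0; last by rewrite fscaleE//; exact: A_fuzzy.1.
by rewrite fscale0E indic1E; case: eqP; rewrite ?lexx ?ler01.
Qed.

Hypothesis A_asym : asymmetric A.

(** A crisp number is symmetric about its value; the affine change of variable
makes the lemma usable on both sides of an equation between multiples of [A]. *)
Lemma asymmetric_not_crisp c d s : s != 0 ->
  ~ forall x, A x = fcrisp c (s * x + d).
Proof.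
move=> s0 AE; have [x0] := A_asym ((c - d) / s); apply; rewrite !AE !indic1E.
rewrite mulrBr mulrDr mulrC divfK// addrAC subrK addrAC subrK.
by rewrite -subr_eq0 addrAC subrr add0r oppr_eq0 -(subr_eq0 (c + _)) addrAC subrr add0r.
Qed.

(** The affine map and its inverse both send the interval into itself, so neither
of them can increase its length. *)
Lemma affine_invariant_itv s d l r : s != 0 -> l < r ->
  (forall x, l <= x <= r <-> l <= s * x + d <= r) -> s = 1 \/ s = -1.
Proof.
move=> s0 lr sd.
have inv y : s * ((y - d) / s) + d = y by rewrite mulrC divfK// subrK.
have /andP[l1 l2] : l <= s * l + d <= r by apply: (sd l).1; rewrite lexx ltW.
have /andP[r1 r2] : l <= s * r + d <= r by apply: (sd r).1; rewrite lexx ltW.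
have /andP[l3 l4] : l <= (l - d) / s <= r by apply: (sd _).2; rewrite inv lexx ltW.
have /andP[r3 r4] : l <= (r - d) / s <= r by apply: (sd _).2; rewrite inv lexx ltW.
have := inv l; have := inv r; move: ((l - d) / s) ((r - d) / s) l3 l4 r3 r4.
move=> u v l3 l4 r3 r4 vE uE; case: (ltgtP s 0) s0 => // sgt0 _.
  by right; apply/eqP; rewrite eq_le; apply/andP; split; nra.
by left; apply/eqP; rewrite eq_le; apply/andP; split; nra.
Qed.

(** If the slope is not 1 or -1, every positive level set is a singleton by
[affine_invariant_itv]; level sets being nested, these singletons coincide and
[A] is crisp. Slope -1 is a point symmetry, and a nonzero translation cannot
preserve the bounded level set at 1. *)
Lemma asymmetric_affine s d : s != 0 -> (forall x, A x = A (s * x + d)) ->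
  s = 1 /\ d = 0.
Proof.
move=> s0 Asd.
have s1 : s = 1 \/ s = -1.
  apply: contrapT => s1.
  have lev1 a : 0 < a <= 1 -> exists c, forall x, a <= A x <-> x = c.
    move=> /andP[a0 a1]; have [|l [r [lr]]] := A_fuzzy.2 a; first by rewrite ltW.
    rewrite level_gt0// => /seteqP[AL AR].
    have AE x : a <= A x <-> l <= x <= r by split; [exact: AL|exact: AR].
    exists l => x; split=> [|->]; last by apply/AE; rewrite lexx.
    move/AE; have [<-|ltlr] := eqVneq l r.
      by move=> /andP[lx xl]; apply/eqP; rewrite eq_le lx xl.
    case: s1; apply: (affine_invariant_itv (d := d) s0 (l := l) (r := r)).
      by rewrite lt_neqAle ltlr.
    by move=> y; split=> /AE; [rewrite Asd|rewrite -Asd] => /AE.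
  have [|c Ac] := lev1 1; first by rewrite ltr01 lexx.
  apply: (asymmetric_not_crisp (c := c) (d := 0) (s := 1)); first exact: oner_neq0.
  move=> x; rewrite mul1r addr0 indic1E; have /andP[Ax0 Ax1] := A_fuzzy.1 x.
  have [->|xc] := eqVneq x c.
    by apply/eqP; rewrite eq_le (Ac c).2// andbT; have /andP[] := A_fuzzy.1 c.
  apply: contrapT => /eqP Ax; have Ax01 : 0 < A x <= 1 by rewrite lt_def Ax Ax0.
  have [e Ae] := lev1 _ Ax01; move/eqP: xc; apply.
  by rewrite (Ae x).1//; apply/esym/Ae; rewrite (le_trans Ax1)//; apply/Ac.
case: s1 Asd => -> Asd; split=> //.
  have [|l [r [lr]]] := A_fuzzy.2 1; first by rewrite ler01 lexx.
  rewrite level_gt0// => /seteqP[AL AR].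
  have /= /andP[l1 l2] : l <= 1 * l + d <= r.
    by apply: (AL (1 * l + d)); rewrite /= -Asd; apply: AR; rewrite /= lexx.
  have /= /andP[r1 r2] : l <= 1 * r + d <= r.
    by apply: (AL (1 * r + d)); rewrite /= -Asd; apply: AR; rewrite /= lexx lr.
  by lra.
all: have [x0] := A_asym (d / 2); case; rewrite Asd; congr (A _); lra.
Qed.

Definition real_affine q r : R -> R := fadd (fcrisp q) (fscale r A).

Lemma real_affine_inj q r q' r' : real_affine q r = real_affine q' r' -> q = q' /\ r = r'.
Proof.
move=> /(congr1 (fun f => f _)) /= E.
have {}E x : fscale r A (x - q) = fscale r' A (x - q').
  by rewrite -!faddE//; [exact: E|exact: fscale01|exact: fscale01].
have [r0|r0] := eqVneq r 0; have [r'0|r'0] := eqVneq r' 0.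
- move: E; rewrite r0 r'0 => /(_ q); rewrite !fscale0E !indic1E subrr eqxx.
  by case: eqP => [/subr0_eq|_ /eqP]; rewrite ?oner_eq0.
- case: (asymmetric_not_crisp (c := 0) (d := q' - q) r'0) => x.
  have := E (r' * x + q'); rewrite addrK (fscaleE _ r'0) [_ / r']mulrC mulKf// => <-.
  by rewrite r0 fscale0E mulrC addrA.
- case: (asymmetric_not_crisp (c := 0) (d := q - q') r0) => x.
  have := E (r * x + q); rewrite addrK (fscaleE _ r0) mulrC mulKf// => ->.
  by rewrite r'0 fscale0E mulrC addrA.
have rr' : r / r' != 0 by rewrite mulf_neq0// invr_neq0.
have [] := asymmetric_affine (d := (q - q') / r') rr'.
  move=> x; have := E (r * x + q).
  rewrite addrK (fscaleE _ r0) (fscaleE _ r'0) [_ / r]mulrC mulKf// => ->.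
  by congr (A _); field.
move=> /divr1_eq <- /eqP; rewrite mulf_eq0 invr_eq0 (negbTE r0) orbF subr_eq0.
by move=> /eqP.
Qed.

End scale.
End fuzzy_coordinates.

Section CF_coordinates.
Context {R : realType} (A : R -> R).
Hypotheses (A_fuzzy : fuzzy_number A) (A_asym : asymmetric A).

(** The real and imaginary parts of an equation between numbers u + vA are two
equations between real affine expressions in [A]. *)
Lemma coords_psi (u v : R[i]) : coords (psi A u v) = (u, v).
Proof.
rewrite /coords; case: cid => -[[a b] [c d]] /=.
case: u v => [u u'] [v v'] [/= /(real_affine_inj A_fuzzy A_asym)[-> ->]].
by move=> /(real_affine_inj A_fuzzy A_asym)[-> ->].
Qed.

Lemma ucoord_psi u v : ucoord (psi A u v) = u.
Proof. by rewrite /ucoord coords_psi. Qed.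

Lemma vcoord_psi u v : vcoord (psi A u v) = v.
Proof. by rewrite /vcoord coords_psi. Qed.

Lemma psi_coord (Z : CF A) : psi A (ucoord Z) (vcoord Z) = Z.
Proof.
rewrite /psi /ucoord /vcoord /coords; case: cid => uv /=.
by case: Z => z h /= E; exact: eq_exist.
Qed.

End CF_coordinates.

(** * Lebesgue measure, boxes and open sets *)

Section lebesgue_rV.
Context {R : realType} {n : nat}.
Local Notation E := 'rV[R]_n.+1.
Local Notation X := (lebesgue_space R n).
Local Notation mu := (@lebesgue_rV R n).
Implicit Types (O K : set E) (a b x : E) (i : 'I_n.+1) (c : R).

(** Cutting a box by the hyperplane x_i = c gives two boxes whose volumes add up to
the volume of the box, so a cover of a set splits into covers of its two parts. *)
Lemma measurable_half_space i c : measurable ([set x : E | x ord0 i <= c] : set X).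
Proof.
apply: le_caratheodory_measurable => Y /=.
set H := [set x : E | _].
pose low (ab : E * E) : E * E :=
  (ab.1, \row_j (if j == i then Num.min c (ab.2 ord0 j) else ab.2 ord0 j)).
pose high (ab : E * E) : E * E :=
  (\row_j (if j == i then Num.max c (ab.1 ord0 j) else ab.1 ord0 j), ab.2).
have lowP ab : box ab `&` H `<=` box (low ab).
  move=> x [/= xab xc] j /=; rewrite mxE; have /andP[-> xb] := xab j.
  by case: eqP => [->|//]; rewrite le_min xc /=; have /andP[] := xab i.
have highP ab : box ab `&` ~` H `<=` box (high ab).
  move=> x [/= xab /negP xc] j /=; rewrite mxE; have /andP[ax ->] := xab j.
  rewrite andbT; case: eqP => [->|//]; rewrite gt_max ltNge xc /=.
  by have /andP[] := xab i.
have volE ab : box_volume ab = box_volume (low ab) + box_volume (high ab).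
  rewrite /box_volume (bigD1 i)//= [X in _ = X + _](bigD1 i)//=.
  rewrite [X in _ = _ + X](bigD1 i)//= !mxE eqxx.
  under [X in _ = _ * X + _]eq_bigr => j ji do rewrite mxE (negbTE ji).
  under [X in _ = _ + _ * X]eq_bigr => j ji do rewrite mxE (negbTE ji).
  rewrite -mulrDl; congr (_ * _).
  rewrite /Num.max /Num.min; do ![case: ifPn]; rewrite -?leNgt => *; lra.
apply: le_ereal_inf_tmp => _ [B YB <-].
under eq_eseriesr => k _ do rewrite volE EFinD.
rewrite nneseriesD; [|by move=> *; exact: box_volume_ge0..].
apply: leeD; apply: ereal_inf_lbound.
  exists (low \o B) => // x [/YB[k _ xB] xH]; exists k => //.
  by apply: lowP; split.
exists (high \o B) => // x [/YB[k _ xB] xH]; exists k => //.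
by apply: highP; split.
Qed.

Lemma measurable_half_space_lt i c : measurable ([set x : E | c < x ord0 i] : set X).
Proof.
rewrite (_ : [set x | _] = ~` [set x : E | x ord0 i <= c]).
  by apply: measurableC; exact: measurable_half_space.
by apply/seteqP; split=> x /=; rewrite ltNge => /negP.
Qed.

Lemma lebesgue_box_le (ab : E * E) : (lebesgue_outer (box ab) <= (box_volume ab)%:E)%E.
Proof.
apply: ereal_inf_lbound.
(* The box with both corners at 0 is empty and has volume 0. *)
exists (fun k => if k == 0 then ab else (0, 0)); first by move=> x; exists 0.
rewrite (@nneseriesD1 _ _ 0%N)//=; last by move=> *; exact: box_volume_ge0.
rewrite eseries0 ?adde0// => k _ /= /negbTE ->.
by rewrite /box_volume big_ord_recl /= mxE subrr maxxx mul0r.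
Qed.

Definition open_box (ab : E * E) : set E :=
  [set x | forall i, ab.1 ord0 i < x ord0 i < ab.2 ord0 i].
Definition closed_box (ab : E * E) : set E :=
  [set x | forall i, ab.1 ord0 i <= x ord0 i <= ab.2 ord0 i].

Lemma compact_closed_box ab : compact (closed_box ab).
Proof.
have := @rV_compact R n.+1 (fun i => `[ab.1 ord0 i, ab.2 ord0 i]%classic)
  (fun i => @segment_compact R _ _).
congr compact; apply/seteqP; split=> x /= xab i; have := xab i;
  by rewrite in_itv.
Qed.

Lemma sub_open_closed_box ab : open_box ab `<=` closed_box ab.
Proof. by move=> x xab i; have /andP[/ltW -> /ltW ->] := xab i. Qed.

Definition rat_box (ab : 'rV[rat]_n.+1 * 'rV[rat]_n.+1) : E * E :=
  (map_mx ratr ab.1, map_mx ratr ab.2).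

(** Rational boxes, so that the union is countable; the closed boxes are required
to lie in the open set since they will contain the supports of bumps. *)
Lemma open_bigcup_box O : open O ->
  O = \bigcup_(ab in [set ab | closed_box (rat_box ab) `<=` O]) open_box (rat_box ab).
Proof.
move=> oO; apply/seteqP; split=> [x Ox|x [ab /= abO]]; last first.
  by move=> /sub_open_closed_box; exact: abO.
have /nbhs_ballP[e /= e0 xeO] : nbhs x O by exact: open_nbhs_nbhs.
have [p pP] : exists p : 'I_n.+1 -> rat,
    forall i, ratr (p i) \in `]x ord0 i - e / 2, x ord0 i[.
  apply: (fin_all_exists (P := fun i q => ratr q \in `]x ord0 i - e / 2, x ord0 i[)) => i.
  by apply: rat_in_itvoo; rewrite ltrBlDr ltrDl divr_gt0.
have [q qP] : exists q : 'I_n.+1 -> rat,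
    forall i, ratr (q i) \in `]x ord0 i, x ord0 i + e / 2[.
  apply: (fin_all_exists (P := fun i q => ratr q \in `]x ord0 i, x ord0 i + e / 2[)) => i.
  by apply: rat_in_itvoo; rewrite ltrDl divr_gt0.
exists (\row_i p i, \row_i q i) => [y /= yab|i]; rewrite /= ?mxE.
  apply: xeO; split=> // j i; rewrite ord1; have := yab i; rewrite /= !mxE.
  rewrite /ball /= ltr_norml; have := pP i; have := qP i; rewrite !in_itv /=.
  by move=> /andP[? ?] /andP[? ?] /andP[? ?]; apply/andP; split; lra.
by have := pP i; have := qP i; rewrite !in_itv /= => /andP[-> _] /andP[_ ->].
Qed.

Lemma measurable_open_box ab : measurable (open_box ab : set X).
Proof.
rewrite (_ : open_box ab = \bigcap_(i in [set: 'I_n.+1])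
    ([set x : E | ab.1 ord0 i < x ord0 i] `&` [set x : E | x ord0 i < ab.2 ord0 i])).
  apply: fin_bigcap_measurable => [|i _]; first exact: finite_finset.
  apply: measurableI; first exact: measurable_half_space_lt.
  rewrite (_ : mkset _ = \bigcup_k [set x : E | x ord0 i <= ab.2 ord0 i - k.+1%:R^-1]).
    by apply: bigcup_measurable => k _; exact: measurable_half_space.
  apply/seteqP; split=> [x /= xb|x [k _ /= xk]].
    have [k kP] := ltr_add_invr xb; exists k => //=.
    by rewrite lerBrDr ltW.
  by rewrite (le_lt_trans xk)// ltrBlDr ltrDl invr_gt0.
by apply/seteqP; split => [x xab i _|x xab i] /=; [apply/andP|apply/andP]; exact: xab.
Qed.

Lemma measurable_open O : open O -> measurable (O : set X).
Proof.
move=> /open_bigcup_box ->; rewrite bigcup_mkcond.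
apply: countable_bigcupT_measurable; first exact: countableP.
by move=> ab; case: ifP => _; [exact: measurable_open_box|exact: measurable0].
Qed.

Lemma measurable_closed O : closed O -> measurable (O : set X).
Proof.
by move=> cO; rewrite -(setCK O); apply/measurableC/measurable_open/closed_openC.
Qed.

Lemma measurable_compact K : compact K -> measurable (K : set X).
Proof.
by move=> /(compact_closed (@norm_hausdorff _ _)); exact: measurable_closed.
Qed.

Lemma measurable_continuous (D : set X) (f : E -> R) :
  continuous f -> measurable_fun D (f : X -> R).
Proof.
move=> cf; apply: (@measurable_funS _ _ _ _ setT) => //.
apply: (measurability _ (measurable_realfun.RGenOInfty.measurableE R)) => _ [_ [a ->] <-].
rewrite setTI; apply: measurable_open; apply: open_comp => [x _|]; first exact: cf.
exact: rray_open.
Qed.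

(** The union of a cover by boxes has measure at most the sum of their volumes. *)
Lemma lebesgue_outer_cover (S : set X) (e : R) : 0 < e -> (mu S < +oo)%E ->
  exists2 B : nat -> E * E, S `<=` \bigcup_k box (B k) &
  (mu (\bigcup_k box (B k)) <= mu S + e%:E)%E.
Proof.
move=> e0 Soo.
have Sfin : mu S \is a fin_num by rewrite ge0_fin_numE.
have [_ [B SB <-] lB] := lb_ereal_inf_adherent e0 Sfin.
exists B => //; apply: le_trans (ltW lB).
apply: (le_trans (@outer_measure_sigma_subadditive _ _ (@lebesgue_outer R n) _)).
by apply: lee_nneseries => k *; [exact: lebesgue_outer_ge0|exact: lebesgue_box_le].
Qed.

End lebesgue_rV.

(** * A smooth function flat at the origin *)

Section flat_function.
Context {R : realType}.
Implicit Types (q : {poly R}) (s t : R).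

(** A family stable under derivation, which starts at q = 1 with the classical
function exp (- 1 / t): differentiating multiplies the exponential by 1 / t ^ 2 and
q (1 / t) has derivative - q' (1 / t) / t ^ 2. *)
Definition flat q t : R := if 0 < t then q.[t^-1] * expR (- t^-1) else 0.

(** One term x ^ (k+1) / (k+1)! of the exponential series already dominates a
monomial; the extra factor [s ^+ k] makes the induction on [q] go through. *)
Lemma poly_expRN_bounded q k : exists C : R, forall s, 0 < s ->
  `|q.[s]| * s ^+ k * expR (- s) <= C.
Proof.
have mono k' : exists C : R, forall s, 0 < s -> s ^+ k' * expR (- s) <= C.
  case: k' => [|k']; first by exists 1 => s s0; rewrite mul1r expR_le1 oppr_le0 ltW.
  exists (k'.+1)`!%:R => s s0; rewrite expRN ler_pdivrMr ?expR_gt0//.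
  rewrite mulrC -ler_pdivrMr ?ltr0n ?fact_gt0//.
  by apply: le_trans (expR_ge1Dxn k' (ltW s0)); rewrite lerDr.
elim/poly_ind: q k => [|q c IH] k.
  by exists 0 => s s0; rewrite horner0 normr0 !mul0r.
have [C HC] := IH k.+1; have [D HD] := mono k.
exists (C + `|c| * D) => s s0; rewrite !hornerE.
have w0 : 0 <= s ^+ k * expR (- s) by rewrite mulr_ge0 ?expR_ge0// exprn_ge0// ltW.
apply: (@le_trans _ _ (`|q.[s]| * s ^+ k.+1 * expR (- s) + `|c| * (s ^+ k * expR (- s)))).
  rewrite exprS !mulrA -mulrDl -mulrDl -!mulrA ler_wpM2r//.
  by rewrite (le_trans (ler_normD _ _))// normrM (gtr0_norm s0).
by rewrite lerD ?HC// ler_wpM2l// HD.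
Qed.

(** The quadratic bound gives differentiability at 0 with derivative 0. *)
Lemma flat_bound q : exists2 C : R, 0 <= C & forall t, `|flat q t| <= C * t ^+ 2.
Proof.
have [C HC] := poly_expRN_bounded q 2.
have C0 : 0 <= C.
  apply: le_trans (HC 1 ltr01); rewrite expr1n mulr1.
  by rewrite mulr_ge0 ?expR_ge0.
exists C => // t; rewrite /flat; case: ifPn => t0; last first.
  by rewrite normr0 mulr_ge0 ?sqr_ge0.
have t2 : 0 < t ^+ 2 by rewrite exprn_gt0.
rewrite normrM (gtr0_norm (expR_gt0 _)) -ler_pdivrMr// -exprVn mulrAC.
by apply: HC; rewrite invr_gt0.
Qed.

Lemma flat_gt0 t : (0 < flat 1 t) = (0 < t).
Proof. by rewrite /flat; case: ifPn; rewrite ?ltxx// hornerE mul1r expR_gt0. Qed.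

Lemma flat_ge0 t : 0 <= flat 1 t.
Proof. by rewrite /flat; case: ifPn; rewrite // hornerE mul1r expR_ge0. Qed.

Lemma flat_le1 t : flat 1 t <= 1.
Proof.
rewrite /flat; case: ifPn; rewrite // hornerE mul1r => t0.
by rewrite expR_le1 oppr_le0 invr_ge0 ltW.
Qed.

Lemma is_derive_flat q t : is_derive t 1 (flat q) (flat ('X^2 * (q - q^`())) t).
Proof.
have [t0|t0|->] := ltgtP t 0.
- rewrite {2}/flat ltNge ltW//=.
  apply: (@near_eq_is_derive _ _ _ (cst 0)).
  near=> s; rewrite /flat ltNge ltW//.
  by near: s; exact: lt_nbhsl.
- rewrite {2}/flat t0.
  apply: (@near_eq_is_derive _ _ _ ((horner q \o GRing.inv) * (expR \o (-%R \o GRing.inv)))).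
    near=> s; rewrite /flat; have -> // : 0 < s by near: s; exact: lt_nbhsr.
  have tn0 : t != 0 by rewrite gt_eqF.
  have dV : is_derive t 1 (GRing.inv : R -> R) (- t ^- 2).
    apply: DeriveDef; first by apply: derivableV => //; exact: derivable_id.
    rewrite (@deriveV _ _ id)// derive_id.
    by rewrite [_ *: _]mulr1.
  apply: is_derive_eq; rewrite /= !hornerE.
  rewrite /GRing.scale /=; field.
  by [].
have [C C0 HC] := flat_bound q.
have f0 p : flat p 0 = 0 by rewrite /flat ltxx.
(* At 0 both the derivative and the claimed value are 0. *)
suff H : (fun h => h^-1 *: ((flat q \o shift 0) (h *: 1) - flat q 0)) @ 0^' --> (0 : R).
  by rewrite f0; apply: DeriveDef; [apply/cvg_ex; exists 0|exact: cvg_lim].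
apply: (@squeeze_cvgr _ _ _ _ (fun h => - (C * `|h|)) (fun h => C * `|h|)).
- near=> h; rewrite f0 subr0 /= addr0 [h%:A]mulr1 -ler_norml normrM normfV.
  have h0 : 0 < `|h| by rewrite normr_gt0; near: h; exact: nbhs_dnbhs_neq.
  by rewrite mulrC ler_pdivrMr// -mulrA -expr2 real_normK ?num_real.
- rewrite -[X in _ --> X]oppr0 -[X in - X](mulr0 C); apply: cvgN; apply: cvgMr.
  rewrite -[X in _ --> X](normr0 R).
  by apply: cvg_norm; exact: nbhs_dnbhs.
- rewrite -[X in _ --> X](mulr0 C); apply: cvgMr.
  rewrite -[X in _ --> X](normr0 R).
  by apply: cvg_norm; exact: nbhs_dnbhs.
Unshelve. all: by end_near. Qed.

End flat_function.

(** * Smooth functions and the commutation of partial derivatives *)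

Section lines.
Context {R : realType} {V : normedModType R}.

(** Reduces directional derivatives to derivatives in one real variable, for which
the mean value theorem is available. *)
Lemma is_derive_line (f : V -> R) (x v : V) (t df : R) :
  is_derive (t *: v + x) v f df -> is_derive t 1 (fun s => f (s *: v + x)) df.
Proof.
move=> [df_ex dfE]; have E :
    (fun h : R => h^-1 *: (((fun s => f (s *: v + x)) \o shift t) (h *: 1) -
                           f (t *: v + x))) =
    (fun h => h^-1 *: ((f \o shift (t *: v + x)) (h *: v) - f (t *: v + x))).
  by apply/funext => h /=; rewrite [h%:A]mulr1 scalerDl addrA.
by apply: DeriveDef; rewrite /derivable/derive E.
Qed.

Lemma derive_line (f : V -> R) (x v : V) :
  'D_v f x = 'D_1 (fun s : R => f (s *: v + x)) 0.
Proof.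
have E : (fun h : R => h^-1 *: ((f \o shift x) (h *: v) - f x)) =
    (fun h : R => h^-1 *: (((fun s : R => f (s *: v + x)) \o shift 0) (h *: 1)
                         - f (0 *: v + x))).
  by apply/funext => h /=; rewrite [h%:A]mulr1 addr0 scale0r add0r.
by rewrite /derive E.
Qed.
End lines.

Section smooth.
Context {R : realType} {n : nat}.
Local Notation E := 'rV[R]_n.+1.
Implicit Types (f g : E -> R) (i j : 'I_n.+1).
Local Notation e i := (delta_mx 0 i : E).

(** Smoothness quantifies over all iterated partial derivatives; it is enough to
exhibit a class of differentiable functions stable under partial derivatives. *)
Lemma smooth_coind (S : (E -> R) -> Prop) :
  (forall f, S f -> (forall x, differentiable f x) /\ forall i, S (partial i f)) ->
  forall f, S f -> smooth f.
Proof.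
move=> HS f Sf s; suff : S (foldr partial f s) by move=> /HS[].
by elim: s => //= i s /HS[_]; exact.
Qed.

Lemma smooth_differentiable f x : smooth f -> differentiable f x.
Proof. by move=> /(_ [::]); exact. Qed.

Lemma smooth_continuous f : smooth f -> continuous f.
Proof. by move=> sf x; apply: differentiable_continuous; exact: smooth_differentiable. Qed.

Lemma smooth_foldr f s : smooth f -> smooth (foldr partial f s).
Proof. by move=> sf s'; rewrite -foldr_cat; exact: sf. Qed.

Lemma smooth_partial i f : smooth f -> smooth (partial i f).
Proof. exact: (@smooth_foldr _ [:: i]). Qed.

(** The derivative of a product of smooth functions is a sum of products of smooth
functions: a class stable under derivation must contain both operations. *)
Inductive smooth_alg : (E -> R) -> Prop :=
| SmoothBase f of smooth f : smooth_alg f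
| SmoothAdd f g of smooth_alg f & smooth_alg g : smooth_alg (f + g)
| SmoothMul f g of smooth_alg f & smooth_alg g : smooth_alg (f * g).

Lemma smooth_alg_smooth f : smooth_alg f -> smooth f.
Proof.
apply: smooth_coind => {}f; elim=> {f}[f sf|f g _ [df af] _ [dg ag]|f g fS [df af] gS [dg ag]].
- split=> [x|i]; first exact: smooth_differentiable.
  by apply: SmoothBase; exact: smooth_partial.
- split=> [x|i]; first exact: differentiableD.
  rewrite (_ : partial i _ = partial i f + partial i g); first exact: SmoothAdd.
  by apply/funext => x; rewrite /partial deriveD//; exact: diff_derivable.
- split=> [x|i]; first exact: differentiableM.
  rewrite (_ : partial i _ = f * partial i g + g * partial i f).
    by apply: SmoothAdd; exact: SmoothMul.
  by apply/funext => x; rewrite /partial deriveM//; exact: diff_derivable.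
Qed.

Lemma smoothM f g : smooth f -> smooth g -> smooth (f * g).
Proof. by move=> sf sg; apply: smooth_alg_smooth; apply: SmoothMul; exact: SmoothBase. Qed.

Lemma partial_cst i (c : R) : partial i (cst c) = cst 0.
Proof. by apply/funext => x; rewrite /partial derive_cst. Qed.

Lemma smooth_cst (c : R) : smooth (cst c : E -> R).
Proof.
apply: (@smooth_coind (fun f => exists c, f = cst c)); last by exists c.
move=> _ [d ->]; split=> [x|i]; first exact: differentiable_cst.
by rewrite partial_cst; exists 0.
Qed.

Lemma smooth_prod (I : Type) (r : seq I) (F : I -> E -> R) :
  (forall k, smooth (F k)) -> smooth (fun x => \prod_(k <- r) F k x).
Proof.
move=> sF; elim: r => [|k r IH].
  by rewrite (_ : (fun _ => _) = cst 1); [exact: smooth_cst|apply/funext => x; rewrite big_nil].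
rewrite (_ : (fun _ => _) = F k * (fun x => \prod_(k <- r) F k x)).
  exact: smoothM.
by apply/funext => x; rewrite big_cons.
Qed.

Lemma differentiable_affine_coord (f : R -> R) (c d : R) i (x : E) :
  derivable f (c * x ord0 i + d) 1 ->
  differentiable (fun y : E => f (c * y ord0 i + d)) x.
Proof.
move=> /derivable1_diffP df.
apply: (@differentiable_comp _ _ _ _ (fun y : E => c * y ord0 i + d)) => //.
apply: differentiableD; last exact: differentiable_cst.
by apply: differentiableM; [exact: differentiable_cst|exact: differentiable_coord].
Qed.

Lemma partial_affine_coord (f : R -> R) (c d : R) i j (x : E) df :
  is_derive (c * x ord0 i + d) 1 f df ->
  partial j (fun y : E => f (c * y ord0 i + d)) x = c * (i == j)%:R * df.
Proof.
move=> fdf; rewrite /partial derive_line.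
pose l (s : R) : R := (c * (i == j)%:R) * s + (c * x ord0 i + d).
rewrite (_ : (fun s => _) = f \o l); last first.
  apply/funext => s; rewrite /l /= !mxE eqxx /=; congr f.
  by rewrite eq_sym; ring.
have dl : is_derive (0 : R) (1 : R) l (c * (i == j)%:R).
  rewrite (_ : l = (c * (i == j)%:R) \*: id + cst (c * x ord0 i + d)); last by [].
  by apply: is_derive_eq; rewrite addr0 [_ *: _]mulr1.
have {}fdf : is_derive (l 0) 1 f df by rewrite /l mulr0 add0r.
by rewrite derive_val mulrC.
Qed.

Lemma smooth_flat_coord (q : {poly R}) (c d : R) i :
  smooth (fun y : E => flat q (c * y ord0 i + d)).
Proof.
pose S f := exists (k : R) (q : {poly R}), f = fun y : E => k * flat q (c * y ord0 i + d).
suff: S (fun y : E => flat q (c * y ord0 i + d)).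
  apply: smooth_coind => _ [k [{}q ->]]; split=> [x|j].
    apply: differentiableM; first exact: differentiable_cst.
    by apply: differentiable_affine_coord; have [] := is_derive_flat q (c * x ord0 i + d).
  exists (k * (c * (i == j)%:R)), ('X^2 * (q - q^`())); apply/funext => x.
  have dq := is_derive_flat q (c * x ord0 i + d).
  have kdq : is_derive (c * x ord0 i + d) 1 (k \*: flat q)
      (k *: flat ('X^2 * (q - q^`())) (c * x ord0 i + d)).
    exact: is_deriveZ.
  rewrite (_ : (fun y : E => _) = fun y : E => (k \*: flat q) (c * y ord0 i + d))//.
  by rewrite (partial_affine_coord _ kdq) /GRing.scale/=; ring.
by exists 1, q; apply/funext => x; rewrite mul1r.
Qed.

(** Mean value theorem applied first in the direction [e i], to the increment of [f]
along [e j], then in the direction [e j]. *)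
Lemma second_difference f i j (x : E) (t : R) : smooth f -> 0 <= t ->
  exists s r, [/\ 0 <= s <= t, 0 <= r <= t &
    f (t *: e i + (t *: e j + x)) - f (t *: e i + x) - (f (t *: e j + x) - f x)
    = t * t * partial j (partial i f) (s *: e i + (r *: e j + x))].
Proof.
move=> sf t0; have di h y : smooth h -> forall k, is_derive y (e k) h (partial k h y).
  move=> sh k; apply: DeriveDef => //; apply: diff_derivable; exact: smooth_differentiable.
have cont (h : R -> R) (dh : R -> R) :
    (forall s : R, is_derive s (1 : R) h (dh s)) -> {within `[0, t], continuous h}.
  move=> hh; apply: continuous_subspaceT => s.
  by apply: differentiable_continuous; apply/derivable1_diffP; have [] := hh s.
pose g (s : R) := f (s *: e i + (t *: e j + x)) - f (s *: e i + x).
have dg (s : R) : is_derive s 1 g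
    (partial i f (s *: e i + (t *: e j + x)) - partial i f (s *: e i + x)).
  by apply: is_deriveB; apply: is_derive_line; exact: di.
have [s s0t gE] := MVT_segment t0 (fun s _ => dg s) (cont _ _ dg).
pose k (r : R) := partial i f (r *: e j + (s *: e i + x)).
have dk (r : R) : is_derive r 1 k (partial j (partial i f) (r *: e j + (s *: e i + x))).
  by apply: is_derive_line; apply: di; exact: smooth_partial.
have [r r0t kE] := MVT_segment t0 (fun s _ => dk s) (cont _ _ dk).
exists s, r; split; [by rewrite in_itv in s0t|by rewrite in_itv in r0t|].
move: gE; rewrite /g !scale0r !add0r subr0 => ->.
move: kE; rewrite /k !scale0r !add0r subr0 => kE.
rewrite [in LHS]addrCA kE mulrC -mulrA [partial _ _ _ * t]mulrC.
by rewrite addrCA.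
Qed.

(** Schwarz's theorem. The second difference is symmetric in the two directions, so
both mixed derivatives take a common value at points arbitrarily close to x,
and they are continuous. *)
Lemma partial_comm f i j : smooth f -> partial j (partial i f) = partial i (partial j f).
Proof.
move=> sf; apply/funext => x; apply: contrapT => /eqP neq.
set D1 := partial j (partial i f) in neq *; set D2 := partial i (partial j f) in neq *.
have d0 : 0 < `|D1 x - D2 x| / 2 by rewrite divr_gt0// normr_gt0 subr_eq0.
have c1 : continuous D1 by apply: smooth_continuous; do 2!apply: smooth_partial.
have c2 : continuous D2 by apply: smooth_continuous; do 2!apply: smooth_partial.
have n1 : \forall y \near x, `|D1 x - D1 y| < `|D1 x - D2 x| / 2.
  by move/cvgrPdist_lt: (c1 x) => /(_ _ d0).
have n2 : \forall y \near x, `|D2 x - D2 y| < `|D1 x - D2 x| / 2.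
  by move/cvgrPdist_lt: (c2 x) => /(_ _ d0).
(* Side t / 3: the displacement s *: e i + r *: e j then has sup norm below t, even
   when i = j. *)
have [t /= t0 tP] := (nbhs_ballP x _).1 (filterI n1 n2).
have t30 : 0 <= t / 3 by rewrite divr_ge0// ltW.
have near_x i1 i2 (s r : R) : 0 <= s <= t / 3 -> 0 <= r <= t / 3 ->
    ball x t (s *: e i1 + (r *: e i2 + x)).
  move=> /andP[s0 st] /andP[r0 rt]; split=> // i0 j0; rewrite ord1 /ball /= !mxE !eqxx /=.
  rewrite addrA opprD addrCA subrr addr0 normrN.
  by case: (j0 == i1); case: (j0 == i2); rewrite ?(mulr1, mulr0, addr0, add0r, normr0)//
    ger0_norm ?addr_ge0//; lra.
have [s [r [s0 r0 E1]]] := second_difference i j x sf t30.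
have [s' [r' [s0' r0' E2]]] := second_difference j i x sf t30.
have t3n0 : t / 3 * (t / 3) != 0 by rewrite mulf_neq0// gt_eqF// divr_gt0.
have : D1 (s *: e i + (r *: e j + x)) = D2 (s' *: e j + (r' *: e i + x)).
  have swap (a b c d : R) : a - b - (c - d) = a - c - (b - d) by ring.
  apply: (mulfI t3n0); apply: (etrans (esym E1)); apply: (etrans _ E2).
  by rewrite addrCA; exact: swap.
have [D1y _] := tP _ (near_x i j s r s0 r0).
have [_ D2y] := tP _ (near_x j i s' r' s0' r0').
have dist3 (a b c d : R) : `|a - c| < d / 2 -> `|b - c| < d / 2 -> `|a - b| < d.
  move=> ac bc; have -> : a - b = (a - c) - (b - c) by ring.
  by rewrite [d]splitr; apply: le_lt_trans (ler_normB _ _) _; exact: ltrD.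
by move=> E; rewrite E in D1y; have := dist3 _ _ _ _ D1y D2y; rewrite ltxx.
Qed.

Lemma foldr_partial_rem f i s : smooth f -> i \in s ->
  foldr partial f s = partial i (foldr partial f (rem i s)).
Proof.
move=> sf; elim: s => //= j s IH; rewrite in_cons.
have [->//|ij /= si] := eqVneq i j.
by rewrite (IH si); apply: partial_comm; exact: smooth_foldr.
Qed.

Lemma foldr_partial_perm f s s' : smooth f -> perm_eq s s' ->
  foldr partial f s = foldr partial f s'.
Proof.
move=> sf; elim: s s' => [|i s IH] s' ss'.
  by move/perm_size: ss' => /=; case: s'.
have is' : i \in s' by rewrite -(perm_mem ss') mem_head.
rewrite (foldr_partial_rem sf is') /= (IH (rem i s'))//.
by rewrite -(perm_cons i) (perm_trans ss')// perm_to_rem.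
Qed.

(** The order in which [pderiv] differentiates, as one list of directions, so that
commutation becomes invariance under permutation. *)
Definition multi_seq (alpha : 'I_n.+1 -> nat) : seq 'I_n.+1 :=
  flatten [seq nseq (alpha i) i | i <- enum 'I_n.+1].

Lemma pderivE alpha f : pderiv alpha f = foldr partial f (multi_seq alpha).
Proof.
rewrite /pderiv /multi_seq; elim: (enum _) => //= i s ->.
by rewrite foldr_cat; elim: (alpha i) => //= k ->.
Qed.

Lemma smooth_pderiv alpha f : smooth f -> smooth (pderiv alpha f).
Proof. by rewrite pderivE; exact: smooth_foldr. Qed.

Lemma pderiv_madd alpha beta f : smooth f ->
  pderiv alpha (pderiv beta f) = pderiv (madd alpha beta) f.
Proof.
move=> sf; rewrite !pderivE -foldr_cat; apply: foldr_partial_perm => //.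
rewrite /multi_seq; elim: (enum _) => //= i s IH.
apply/permP => p; rewrite !count_cat !count_nseq.
move/permP: IH => /(_ p); rewrite count_cat => <-; rewrite /madd; lia.
Qed.

Lemma pderiv0 alpha : pderiv alpha (cst 0 : E -> R) = cst 0.
Proof. by rewrite pderivE; elim: multi_seq => //= i s ->; exact: partial_cst. Qed.

End smooth.

(** * Real test functions *)

Section test_functions.
Context {R : realType} {n : nat}.
Local Notation E := 'rV[R]_n.+1.
Implicit Types (f phi chi : E -> R) (Omega : set E).

Definition tsupp phi : set E := closure [set x | phi x <> 0].

Definition real_test Omega phi : Prop :=
  [/\ smooth phi, compact (tsupp phi) & tsupp phi `<=` Omega].

Lemma tsupp_out phi x : ~ tsupp phi x -> \forall y \near x, phi y = 0.
Proof.
rewrite /tsupp closureE => nx.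
have : open (~` tsupp phi) by apply: closed_openC; exact: closed_closure.
rewrite openE => /(_ x); rewrite /tsupp closureE => /(_ nx); apply: filterS => y /= ny.
by apply: contrapT => phiy; apply: ny; rewrite -closureE; exact: subset_closure.
Qed.

Lemma tsupp0 phi x : ~ tsupp phi x -> phi x = 0.
Proof. by move=> /tsupp_out/nbhs_singleton. Qed.

Lemma tsupp_sub phi chi : (forall x, ~ tsupp phi x -> chi x = 0) ->
  tsupp chi `<=` tsupp phi.
Proof.
move=> H; rewrite {1}/tsupp closureE; apply: smallest_sub; first exact: closed_closure.
by move=> x /= cx; apply: contrapT => /H.
Qed.

Lemma real_test_sub Omega phi chi : real_test Omega phi -> smooth chi ->
  (forall x, ~ tsupp phi x -> chi x = 0) -> real_test Omega chi.
Proof.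
move=> [_ cphi phiO] schi /tsupp_sub cp; split=> //; last exact: subset_trans cp phiO.
by apply: subclosed_compact cphi cp; exact: closed_closure.
Qed.

Lemma real_testM Omega phi chi : real_test Omega phi -> smooth chi ->
  real_test Omega (phi * chi).
Proof.
move=> tphi schi; apply: (real_test_sub tphi); first by apply: smoothM => //; have [] := tphi.
by move=> x /tsupp0 phix; rewrite /= [LHS](_ : _ = phi x * chi x)// phix mul0r.
Qed.

(** Vanishing near the point rather than at the point is what is inherited by
partial derivatives. *)
Lemma foldr_partial_out phi s x : ~ tsupp phi x ->
  \forall y \near x, foldr partial phi s y = 0.
Proof.
elim: s x => [|i s IH] x nx /=; first exact: tsupp_out.
have : open (~` tsupp phi) by apply: closed_openC; exact: closed_closure.
rewrite openE => /(_ _ nx); apply: filterS => y /= ny.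
rewrite /partial (@near_eq_derive _ _ _ _ (cst 0)); first exact: derive_cst.
exact: IH.
Qed.

Lemma real_test_pderiv Omega alpha phi : real_test Omega phi ->
  real_test Omega (pderiv alpha phi).
Proof.
move=> tphi; apply: (real_test_sub tphi).
  by apply: smooth_pderiv; have [] := tphi.
by move=> x /(foldr_partial_out (multi_seq alpha))/nbhs_singleton; rewrite pderivE.
Qed.

(** The coefficients 1 and -1 put both factors in the form [flat 1 (c * x_i + d)] of
[smooth_flat_coord]. *)
Definition bump (ab : E * E) : E -> R := fun x =>
  \prod_(i <- enum 'I_n.+1)
    (flat 1 (1 * x ord0 i + - ab.1 ord0 i) * flat 1 (-1 * x ord0 i + ab.2 ord0 i)).

Lemma smooth_bump ab : smooth (bump ab).
Proof.
by apply: smooth_prod => i; apply: smoothM; exact: smooth_flat_coord.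
Qed.

Lemma bump_gt0 ab x : open_box ab x -> 0 < bump ab x.
Proof.
move=> xab; rewrite /bump big_seq; elim/big_rec: _ => // i y _ y0.
have /andP[ax xb] := xab i.
by rewrite mulr_gt0// mulr_gt0// flat_gt0 ?mul1r ?mulN1r ?subr_gt0// addrC subr_gt0.
Qed.

Lemma bump_eq0 ab x : ~ open_box ab x -> bump ab x = 0.
Proof.
move=> /existsNP[i xi]; rewrite /bump (big_rem i) ?mem_enum//=.
apply/eqP; rewrite !mulf_eq0 -!orbA.
have fl0 t : ~~ (0 < t) -> flat 1 t == 0.
  by rewrite -flat_gt0 -leNgt => t0; rewrite eq_le t0 flat_ge0.
move/negP: xi; rewrite negb_and -(subr_gt0 _ (x _ _)) -(subr_gt0 _ (ab.2 _ _)).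
by move=> /orP[] /fl0 h; rewrite mul1r mulN1r; [rewrite h|rewrite (addrC (- _)) h orbT].
Qed.

Lemma real_test_bump Omega ab : closed_box ab `<=` Omega -> real_test Omega (bump ab).
Proof.
move=> abO.
have sub : tsupp (bump ab) `<=` closed_box ab.
  rewrite /tsupp closureE; apply: smallest_sub.
    by apply: compact_closed; [exact: norm_hausdorff|exact: compact_closed_box].
  move=> x /= bx; apply: sub_open_closed_box; apply: contrapT => nx.
  by apply: bx; exact: bump_eq0.
split; [exact: smooth_bump| |exact: subset_trans sub abO].
exact: (subclosed_compact (@closed_closure _ _) (@compact_closed_box R n ab) sub).
Qed.

End test_functions.

(** * The fundamental lemma of the calculus of variations *)

Section fundamental_lemma.
Context {R : realType} {n : nat}.
Local Notation E := 'rV[R]_n.+1.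
Local Notation X := (lebesgue_space R n).
Local Notation mu := (@lebesgue_rV R n).
Variable Omega : set E.
Hypothesis Omega_open : open Omega.
Implicit Types (h g : E -> R) (phi chi : E -> R) (B C : set E).

Let mOmega : measurable (Omega : set X).
Proof. exact: measurable_open. Qed.

Lemma mul_fctE h g (x : E) : (h * g) x = h x * g x.
Proof. by []. Qed.

Definition real_L1loc h : Prop :=
  forall K : set E, compact K -> K `<=` Omega -> mu.-integrable K (EFin \o h).

Lemma integrable_mul_bounded (K : set X) h chi : measurable K ->
  mu.-integrable K (EFin \o h) -> measurable_fun K (chi : X -> R) ->
  (exists M, forall x, K x -> `|chi x| <= M) ->
  mu.-integrable K (EFin \o (h * chi)).
Proof.
move=> mK ih mchi [M HM]; apply: (@integrableMl _ _ _ mu K mK (EFin \o h) chi) => //.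
by exists M; split=> [|N MN x Kx]; [exact: num_real|exact: le_trans (HM x Kx) (ltW MN)].
Qed.

Lemma continuous_compact_bounded (K : set E) chi : compact K -> continuous chi ->
  exists M, forall x, K x -> `|chi x| <= M.
Proof.
move=> cK cchi; have : compact (chi @` K).
  by apply: continuous_compact => //; exact: continuous_subspaceT.
move=> /compact_bounded[M [_ HM]]; exists (M + 1) => x Kx.
by apply: HM; [rewrite ltrDl|exists x].
Qed.

(** The support of the test function is a compact set on which h is integrable and
phi is bounded, and the product vanishes outside it. *)
Lemma integrable_mul_test h phi : real_L1loc h -> real_test Omega phi ->
  mu.-integrable Omega (EFin \o (h * phi)).
Proof.
move=> hL [sphi cphi phiO]; have cp := smooth_continuous sphi.
have mK : measurable (tsupp phi : set X) by exact: measurable_compact.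
apply: (@integrableS _ _ _ mu setT) => //.
rewrite (_ : EFin \o (h * phi) = (EFin \o (h * phi)) \_ (tsupp phi)).
  apply/(integrable_mkcond _ mK).1/integrable_mul_bounded => //.
  - exact: hL.
  - exact: measurable_continuous.
  - exact: continuous_compact_bounded.
apply/funext => x; rewrite patchE; case: ifPn => //.
move=> /negP; rewrite inE => /tsupp0 px.
by rewrite /= [X in X%:E](_ : _ = h x * phi x)// px mulr0.
Qed.

Definition annihilates h : Prop :=
  real_L1loc h /\
  forall phi, real_test Omega phi -> \int[mu]_(x in Omega) ((h * phi) (x : E)) = 0.

Lemma annihilates_sub h g : real_L1loc h -> real_L1loc g ->
  (forall phi, real_test Omega phi ->
    \int[mu]_(x in Omega) ((h * phi) (x : E)) =
    \int[mu]_(x in Omega) ((g * phi) (x : E))) -> annihilates (h - g).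
Proof.
move=> hL gL hg; split=> [K cK KO|phi tphi].
  exact: (integrableB (measurable_compact cK) (hL K cK KO) (gL K cK KO)).
have := RintegralB mOmega (integrable_mul_test hL tphi) (integrable_mul_test gL tphi).
rewrite hg// subrr => <-; apply: eq_Rintegral => x _.
by rewrite /= mulrBl.
Qed.

Lemma annihilatesB h g : annihilates h -> annihilates g -> annihilates (h - g).
Proof.
by move=> [hL h0] [gL g0]; apply: annihilates_sub => // phi tphi; rewrite h0 ?g0.
Qed.

Lemma annihilates_smooth h chi : smooth chi -> annihilates h -> annihilates (h * chi).
Proof.
move=> schi [hL h0]; have cchi := smooth_continuous schi; split=> [K cK KO|phi tphi].
  apply: integrable_mul_bounded; [exact: measurable_compact|exact: hL| |].
  - exact: measurable_continuous.
  - exact: continuous_compact_bounded.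
by rewrite -mulrA (mulrC chi); apply: h0; exact: real_testM.
Qed.

(** The dominating function |h| is locally integrable, and |h phi| is integrable, so
dominated convergence applies on compact sets and to the integrals against a
test function. *)
Lemma annihilates_dominated (h_ : nat -> E -> R) h g : (forall j, annihilates (h_ j)) ->
  real_L1loc h -> (forall j x, `|h_ j x| <= `|h x|) ->
  (forall x, h_ ^~ x @ \oo --> g x) -> annihilates g.
Proof.
move=> ah hL h_h h_g.
have dct (D : set X) (k_ : nat -> E -> R) (k d : E -> R) : measurable D ->
    (forall j, mu.-integrable D (EFin \o k_ j)) -> mu.-integrable D (EFin \o d) ->
    (forall j x, `|k_ j x| <= `|d x|) -> (forall x, k_ ^~ x @ \oo --> k x) ->
    mu.-integrable D (EFin \o k) /\
    (fun j => \int[mu]_(x in D) (k_ j x)%:E)%E @ \oo --> (\int[mu]_(x in D) (k x)%:E)%E.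
  move=> mD ik_ id k_d k_k.
  have mk_ j : measurable_fun D (EFin \o k_ j) by exact: measurable_int (ik_ j).
  have k_kE x : (EFin \o k_ ^~ x) @ \oo --> (k x)%:E by apply: cvg_EFin; [near=> j|exact: k_k].
  have mk : measurable_fun D (EFin \o k).
    by apply: (@emeasurable_fun_cvg _ X R D (fun j => EFin \o k_ j)) => // x _; exact: k_kE.
  have [] := @dominated_convergence _ _ _ mu D mD (fun j => EFin \o k_ j) (EFin \o k)
    (abse \o (EFin \o d)) mk_ mk.
  - by apply: aeW => x _; exact: k_kE.
  - exact: integrable_abse.
  - by apply: aeW => x j _; rewrite /= lee_fin.
  by move=> ik _ ck; split.
split=> [K cK KO|phi tphi].
  apply: (dct K h_ g h _ _ _ h_h h_g).1; [exact: measurable_compact| |exact: hL].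
  by move=> j; exact: (ah j).1.
have [] := dct Omega (fun j => h_ j * phi) (g * phi) (h * phi) mOmega.
- by move=> j; exact: integrable_mul_test (ah j).1 tphi.
- exact: integrable_mul_test.
- by move=> j x; rewrite /= !normrM ler_wpM2r.
- by move=> x; apply: cvgMl; exact: h_g.
move=> _; rewrite (_ : (fun j => _) = cst 0%E).
  by move=> /(cvg_lim (@ereal_hausdorff R)); rewrite lim_cst// /Rintegral => <-.
apply/funext => j; rewrite /cst -[LHS]fineK; last first.
  by apply: integrable_fin_num => //; exact: integrable_mul_test (ah j).1 tphi.
by congr (_%:E); exact: (ah j).2.
Unshelve. all: by end_near. Qed.

(** By the lemmas below these sets form a sigma-algebra containing the boxes. *)
Definition localizing B : Prop :=
  measurable (B : set X) /\ forall h, annihilates h -> annihilates (h * \1_B).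

Lemma localizing_setT : localizing setT.
Proof. by split=> // h; rewrite indicT mulr1. Qed.

Lemma localizingC B : localizing B -> localizing (~` B).
Proof.
move=> [mB LB]; split=> [|h ah]; first exact: measurableC.
rewrite (_ : h * \1_(~` B) = h - h * \1_B); first by apply: annihilatesB => //; exact: LB.
apply/funext => x; rewrite [RHS](_ : _ = h x - h x * \1_B x)// mul_fctE !indicE.
by rewrite in_setC; case: (x \in B); rewrite /= ?mulr1 ?mulr0 ?subrr ?subr0.
Qed.

Lemma localizingI B C : localizing B -> localizing C -> localizing (B `&` C).
Proof.
move=> [mB LB] [mC LC]; split=> [|h ah]; first exact: measurableI.
rewrite (_ : h * \1_(B `&` C) = h * \1_B * \1_C); first exact/LC/LB.
by apply/funext => x; rewrite !mul_fctE !indicE in_setI -mulrA -natrM mulnb.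
Qed.

(** The products of h with indicators of finite intersections are bounded by |h| and
stationary at each point. *)
Lemma localizing_bigcap (C_ : nat -> set E) : (forall k, localizing (C_ k)) ->
  localizing (\bigcap_k C_ k).
Proof.
move=> LC; split=> [|h ah]; first by apply: bigcapT_measurable => k; exact: (LC k).1.
have LN N : localizing (\big[setI/setT]_(k < N) C_ k).
  by apply: (big_ind localizing) => // ; [exact: localizing_setT|exact: localizingI].
apply: (annihilates_dominated (h_ := fun N => h * \1_(\big[setI/setT]_(k < N) C_ k)) (h := h)).
- by move=> N; exact: (LN N).2.
- exact: ah.1.
- move=> N x; rewrite /= normrM ler_piMr// /indic.
  by case: (_ \in _); rewrite ?normr1 ?normr0.
move=> x; apply: cvg_near_cst.
have [Cx|/existsNP[k /not_implyP[_ nC]]] := pselect ((\bigcap_k C_ k) x).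
  near=> N; rewrite !mul_fctE !indicE !mem_set//.
  by rewrite -bigcap_mkord => k _; exact: Cx.
near=> N; rewrite !mul_fctE !indicE !memNset//; first by move=> /(_ k I).
rewrite -bigcap_mkord => /(_ k); apply: contra_not nC; apply => /=.
by near: N; exact: nbhs_infty_gt.
Unshelve. all: by end_near. Qed.

Lemma localizing_bigcup (C_ : nat -> set E) : (forall k, localizing (C_ k)) ->
  localizing (\bigcup_k C_ k).
Proof.
move=> LC; rewrite -(setCK (\bigcup_k _)) setC_bigcup.
by apply: localizingC; apply: localizing_bigcap => k; exact: localizingC.
Qed.

Lemma cvg_flat_step (t : R) :
  (fun j => flat 1 (j.+1%:R * t)) @ \oo --> ((0 < t)%R%:R : R).
Proof.
have [t0|t0] := ltP 0 t; last first.
  apply: cvg_near_cst; near=> j; rewrite /flat ltNge.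
  by rewrite mulr_ge0_le0.
rewrite (_ : (fun j => _) = expR \o (fun j => - (harmonic j * t^-1))); last first.
  apply/funext => j; rewrite /flat mulr_gt0//= hornerE mul1r.
  by rewrite invfM.
rewrite -expR0; apply: continuous_cvg; first exact: continuous_expR.
rewrite -[X in _ --> X]oppr0 -[X in - X](mul0r t^-1); apply: cvgN.
by apply: cvgMl; exact: cvg_harmonic.
Unshelve. all: by end_near. Qed.

Lemma localizing_half_space i (c : R) : localizing [set x : E | c < x ord0 i].
Proof.
split=> [|h ah]; first exact: measurable_half_space_lt.
pose chi j (x : E) : R := flat 1 (j.+1%:R * x ord0 i + - (j.+1%:R * c)).
apply: (annihilates_dominated (h_ := fun j => h * chi j) (h := h)).
- by move=> j; apply: annihilates_smooth => //; exact: smooth_flat_coord.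
- exact: ah.1.
- by move=> j x; rewrite /= normrM ler_piMr// ger0_norm ?flat_ge0 ?flat_le1.
move=> x; apply: cvgMr; rewrite /chi /indic.
under eq_fun do rewrite -mulrBr.
have := @cvg_flat_step (x ord0 i - c); rewrite subr_gt0.
rewrite (_ : (x \in _) = (c < x ord0 i))//.
by apply/idP/idP; rewrite inE.
Qed.

Lemma localizing_box ab : localizing (box ab).
Proof.
rewrite (_ : box ab = \bigcap_(i in [set` enum 'I_n.+1])
    ([set x : E | ab.1 ord0 i < x ord0 i] `&` ~` [set x : E | ab.2 ord0 i < x ord0 i])).
  rewrite bigcap_seq; apply: (big_ind localizing) => [|B C|i _].
  - exact: localizing_setT.
  - exact: localizingI.
  - by apply: localizingI; [|apply: localizingC]; exact: localizing_half_space.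
apply/seteqP; split => [x xab i _|x xab i] /=.
  by have /andP[? xb] := xab i; split=> //; apply/negP; rewrite -leNgt.
have [] := xab i; first by rewrite /= mem_enum.
by move=> /= -> /negP; rewrite -leNgt.
Qed.

(** Intersect covers by boxes whose measures exceed that of S by 1 / (N + 1). *)
Lemma localizing_hull (S : set X) : (mu S < +oo)%E ->
  exists2 U : set E, localizing U & S `<=` U /\ (mu U <= mu S)%E.
Proof.
move=> Soo; have cov N : exists B : nat -> E * E, S `<=` \bigcup_k box (B k) /\
    (mu (\bigcup_k box (B k)) <= mu S + (N.+1%:R^-1)%:E)%E.
  have N0 : 0 < N.+1%:R^-1 :> R by rewrite invr_gt0.
  have [B SB lB] := lebesgue_outer_cover N0 Soo.
  by exists B.
have [B_ BP] := choice cov; exists (\bigcap_N \bigcup_k box (B_ N k)).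
  by apply: localizing_bigcap => N; apply: localizing_bigcup => k; exact: localizing_box.
split=> [x Sx N _|]; first exact: (BP N).1.
apply/lee_addgt0Pr => e e0.
have [N Ne] := ltr_add_invr e0.
apply: le_trans (le_trans (BP N).2 _); last first.
  by rewrite leeD2l// lee_fin ltW//; move: Ne; rewrite add0r.
apply: le_outer_measure; exact: bigcap_inf.
Qed.

(** With a hull U of S, the integral of h times the bump over S equals the integral of
h 1_U times the bump over Omega, which vanishes because U is localizing. *)
Lemma annihilates_ae0_box h ab : annihilates h -> closed_box ab `<=` Omega ->
  {ae mu, forall x : X, open_box ab x -> h x = 0}.
Proof.
move=> ah abO; have mQ := measurable_open_box ab.
have tphi := real_test_bump abO.
have QO : open_box ab `<=` Omega by exact: subset_trans (@sub_open_closed_box _ _ ab) abO.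
have ihO := integrable_mul_test ah.1 tphi.
have ihQ : mu.-integrable (open_box ab) (EFin \o (h * bump ab)) by exact: integrableS ihO.
have Qoo : (mu (open_box ab) < +oo)%E.
  apply: (@le_lt_trans _ _ (box_volume ab)%:E); last exact: ltry.
  apply: le_trans (lebesgue_box_le ab); apply: le_outer_measure => x xab i.
  by have /andP[-> /ltW ->] := xab i.
have S0 (S : set X) : S `<=` open_box ab -> measurable S ->
    (\int[mu]_(x in S) ((h * bump ab) (x : E))%:E = \int[mu]_(x in S) (cst 0 x))%E.
  move=> SQ mS; rewrite integral0.
  have Soo : (mu S < +oo)%E by apply: le_lt_trans Qoo; exact: le_outer_measure.
  have [U [mU LU] [SU US]] := localizing_hull Soo.
  have US0 : mu (U `\` S) = 0.
    have UE : mu U = mu S by apply/eqP; rewrite eq_le US /=; exact: le_outer_measure.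
    have Uoo : (mu U < +oo)%E by rewrite UE.
    apply: (etrans (@measureD _ X R mu U S mU mS Uoo)).
    rewrite (setIidr SU); apply: (etrans (congr1 (fun z => z - mu S)%E UE)).
    by rewrite subee// ge0_fin_numE.
  have [hUL hU0] := LU _ ah.
  have := integrable_fin_num mOmega (integrable_mul_test hUL tphi).
  move=> /fineK; rewrite [fine _](hU0 _ tphi) => E0.
  transitivity (\int[mu]_(x in Omega) ((h * \1_U * bump ab) (x : E))%:E)%E; last by rewrite -E0.
  rewrite (_ : S = S `&` Omega) ?integral_mkcondl; last first.
    by rewrite setIidl//; exact: subset_trans QO.
  apply: ae_eq_integral; first exact: mOmega.
  - apply: (measurable_restrict _ mS mOmega).1.
    by apply: measurable_funS (measurable_int _ ihO).
  - exact: measurable_int (integrable_mul_test hUL tphi).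
  exists (U `\` S); split=> //; first exact: measurableD.
  move=> x /= nE; apply: contrapT => nUS; apply: nE => _.
  rewrite patchE !mul_fctE indicE; case: ifPn => [|/negP]; rewrite inE => Sx.
    by rewrite mem_set ?mulr1//; exact: SU.
  by rewrite memNset ?mulr0 ?mul0r// => Ux; exact: nUS.
have := integral_ae_eq mQ ihQ (measurable_cst _) S0.
apply: filterS => x /= hx xQ; have /eqP := hx xQ.
rewrite eqe [X in X == _](_ : _ = h x * bump ab x)// mulf_eq0 => /orP[/eqP//|].
by rewrite gt_eqF// bump_gt0.
Qed.

(** The rational boxes are enumerated through [unpickle], so that countably many
almost everywhere statements can be combined. *)
Theorem annihilates_ae0 h : annihilates h -> {ae mu, forall x : X, Omega x -> h x = 0}.
Proof.
move=> ah.
pose P k (x : X) := if unpickle k is Some ab then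
  closed_box (rat_box ab) `<=` Omega -> open_box (rat_box ab) x -> h x = 0 else True.
have : {ae mu, forall x k, P k x}.
  apply: ae_foralln => k; rewrite /P; case: unpickle => [ab|]; last exact: aeW.
  have [abO|nabO] := pselect (closed_box (rat_box ab) `<=` Omega); last exact: aeW.
  by apply: filterS (annihilates_ae0_box ah abO) => x hx _.
apply: filterS => x Px; rewrite (open_bigcup_box Omega_open) => -[ab abO xab].
by have := Px (pickle ab); rewrite /P pickleK; exact.
Qed.

End fundamental_lemma.

(** * Integrals of complex-valued functions *)

Local Open Scope complex_scope.

Section complex_integral.
Context {R : realType} {n : nat}.
Local Notation E := 'rV[R]_n.+1.
Local Notation X := (lebesgue_space R n).
Local Notation mu := (@lebesgue_rV R n).
Local Notation C := R[i].
Local Notation Re := (@complex.Re R).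
Local Notation Im := (@complex.Im R).

Lemma ReM (x y : C) : Re (x * y) = Re x * Re y - Im x * Im y.
Proof. by case: x; case: y. Qed.
Lemma ImM (x y : C) : Im (x * y) = Re x * Im y + Im x * Re y.
Proof. by case: x; case: y. Qed.
Lemma ReD (x y : C) : Re (x + y) = Re x + Re y.
Proof. by case: x; case: y. Qed.
Lemma ImD (x y : C) : Im (x + y) = Im x + Im y.
Proof. by case: x; case: y. Qed.
Lemma complex_ext (x y : C) : Re x = Re y -> Im x = Im y -> x = y.
Proof. by case: x => a b; case: y => c d /= -> ->. Qed.

Section real_lin.
Variables (D : set E) (mD : measurable (D : set X)).

Lemma integrable_lin (a b : R) (f g : E -> R) :
  mu.-integrable D (fun x : X => (f x)%:E) -> mu.-integrable D (fun x : X => (g x)%:E) ->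
  mu.-integrable D (fun x : X => (a * f x + b * g x)%:E) /\
  (\int[mu]_(x in D) (a * f x + b * g x))%R =
    a * (\int[mu]_(x in D) f x)%R + b * (\int[mu]_(x in D) g x)%R.
Proof.
move=> fi gi; have afi := integrableZl mD a fi; have bgi := integrableZl mD b gi.
split; first exact: (integrableD mD afi bgi).
apply: (etrans (RintegralD mD afi bgi)); congr (_ + _).
  exact: (RintegralZl a mD fi).
exact: (RintegralZl b mD gi).
Qed.

Lemma cintegrable_lin (c d : C) (f g : E -> C) :
  cintegrable D f -> cintegrable D g ->
  cintegrable D (fun x => c * f x + d * g x) /\
  cintegral D (fun x => c * f x + d * g x) = c * cintegral D f + d * cintegral D g.
Proof.
have scal (e : C) (h : E -> C) : cintegrable D h ->
    cintegrable D (fun x => e * h x) /\ cintegral D (fun x => e * h x) = e * cintegral D h.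
  move=> [hr hi]; have [i1 e1] := integrable_lin (Re e) (- Im e) hr hi.
  have [i2 e2] := integrable_lin (Re e) (Im e) hi hr.
  have rE : (fun x => Re (e * h x)) = (fun x => Re e * Re (h x) + - Im e * Im (h x)).
    by apply/funext => x; rewrite ReM mulNr.
  have iE : (fun x => Im (e * h x)) = (fun x => Re e * Im (h x) + Im e * Re (h x)).
    by apply/funext => x; rewrite ImM.
  split.
    split; first by move: i1; rewrite -[X in integrable _ _ X]/(EFin \o (fun x : X => _)) -rE.
    by move: i2; rewrite -[X in integrable _ _ X]/(EFin \o (fun x : X => _)) -iE.
  apply: complex_ext; rewrite ?ReM ?ImM /= ?rE ?iE ?e1 ?e2 ?mulNr//.
move=> /(scal c)[[f1 f2] fE] /(scal d)[[g1 g2] gE]; rewrite -fE -gE.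
have [i1 e1] := integrable_lin 1 1 f1 g1; have [i2 e2] := integrable_lin 1 1 f2 g2.
have rE : (fun x => Re (c * f x + d * g x)) = (fun x => 1 * Re (c * f x) + 1 * Re (d * g x)).
  by apply/funext => x; rewrite ReD !mul1r.
have iE : (fun x => Im (c * f x + d * g x)) = (fun x => 1 * Im (c * f x) + 1 * Im (d * g x)).
  by apply/funext => x; rewrite ImD !mul1r.
split.
  split; first by move: i1; rewrite -[X in integrable _ _ X]/(EFin \o (fun x : X => _)) -rE.
  by move: i2; rewrite -[X in integrable _ _ X]/(EFin \o (fun x : X => _)) -iE.
by apply: complex_ext; rewrite ?ReD ?ImD /= ?rE ?iE ?e1 ?e2 !mul1r.
Qed.

End real_lin.

End complex_integral.

(** * Weak derivatives of complex-valued functions *)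

Section complex_weak_derivative.
Context {R : realType} {n : nat}.
Local Notation E := 'rV[R]_n.+1.
Local Notation X := (lebesgue_space R n).
Local Notation mu := (@lebesgue_rV R n).
Local Notation C := R[i].
Local Notation Re := (@complex.Re R).
Local Notation Im := (@complex.Im R).
Implicit Types (f g h z w : E -> C) (alpha beta : 'I_n.+1 -> nat).
Variable Omega : set E.
Hypothesis Omega_open : open Omega.
Let mOmega := measurable_open Omega_open.

Definition complex_test z : Prop :=
  real_test Omega (Re \o z) /\ real_test Omega (Im \o z).

Definition complex_L1loc f : Prop :=
  forall K : set E, compact K -> K `<=` Omega -> cintegrable K f.

Definition complex_weak_deriv alpha f g : Prop :=
  [/\ complex_L1loc f, complex_L1loc g & forall z, complex_test z ->
    cintegral Omega (fun x => f x * cpderiv alpha z x) =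
    (-1) ^+ morder alpha * cintegral Omega (fun x => g x * z x)].

Lemma complex_test_pderiv alpha z : complex_test z -> complex_test (cpderiv alpha z).
Proof. by move=> [zr zi]; split; exact: real_test_pderiv. Qed.

Lemma complex_L1loc_Re f : complex_L1loc f -> real_L1loc Omega (Re \o f).
Proof. by move=> fL K cK KO; exact: (fL K cK KO).1. Qed.

Lemma complex_L1loc_Im f : complex_L1loc f -> real_L1loc Omega (Im \o f).
Proof. by move=> fL K cK KO; exact: (fL K cK KO).2. Qed.

Lemma cintegrable_mul_test f z : complex_L1loc f -> complex_test z ->
  cintegrable Omega (fun x => f x * z x).
Proof.
move=> fL [zr zi].
have i1 := integrable_mul_test Omega_open (complex_L1loc_Re fL) zr.
have i2 := integrable_mul_test Omega_open (complex_L1loc_Im fL) zi.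
have i3 := integrable_mul_test Omega_open (complex_L1loc_Re fL) zi.
have i4 := integrable_mul_test Omega_open (complex_L1loc_Im fL) zr.
split.
  by apply: eq_integrable (integrableB mOmega i1 i2) => // x _; rewrite ReM.
by apply: eq_integrable (integrableD mOmega i3 i4) => // x _; rewrite ImM.
Qed.

Lemma morder_madd alpha beta : morder (madd alpha beta) = (morder alpha + morder beta)%N.
Proof. by rewrite /morder /madd big_split. Qed.

Lemma cpderiv_madd alpha beta z : csmooth z ->
  cpderiv alpha (cpderiv beta z) = cpderiv (madd alpha beta) z.
Proof.
move=> [sr si]; apply/funext => x; rewrite /cpderiv -(pderiv_madd alpha beta sr).
by rewrite -(pderiv_madd alpha beta si).
Qed.

(** Test the first derivative against the derivative of order beta of z. *)
Lemma complex_weak_deriv_comp alpha beta f g h :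
  complex_weak_deriv alpha f g -> complex_weak_deriv (madd alpha beta) f h ->
  complex_weak_deriv beta g h.
Proof.
move=> [_ gL fg] [_ hL fh]; split=> // z tz.
have := fg _ (complex_test_pderiv beta tz); rewrite cpderiv_madd; last first.
  by have [[? _ _] [? _ _]] := tz.
rewrite fh// => /(congr1 (fun y => (-1) ^+ morder alpha * y)).
by rewrite !mulrA -expr2 sqrr_sign mul1r morder_madd exprD mulrA -expr2 sqrr_sign mul1r => <-.
Qed.

Lemma complex_weak_deriv_lin alpha (c d : C) f g h k :
  complex_weak_deriv alpha f g -> complex_weak_deriv alpha h k ->
  complex_weak_deriv alpha (fun x => c * f x + d * h x) (fun x => c * g x + d * k x).
Proof.
move=> [fL gL fg] [hL kL hk]; split=> [K cK KO|K cK KO|z tz].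
- exact: (cintegrable_lin (measurable_compact cK) c d (fL K cK KO) (hL K cK KO)).1.
- exact: (cintegrable_lin (measurable_compact cK) c d (gL K cK KO) (kL K cK KO)).1.
have lin f1 f2 y : complex_L1loc f1 -> complex_L1loc f2 -> complex_test y ->
    cintegral Omega (fun x => (c * f1 x + d * f2 x) * y x) =
    c * cintegral Omega (fun x => f1 x * y x) + d * cintegral Omega (fun x => f2 x * y x).
  move=> L1 L2 ty.
  rewrite -(cintegrable_lin mOmega c d (cintegrable_mul_test L1 ty) (cintegrable_mul_test L2 ty)).2.
  by congr cintegral; apply/funext => x; rewrite mulrDl -!mulrA.
rewrite !lin//; last exact: complex_test_pderiv.
by rewrite fg// hk// mulrDr !mulrA (mulrC c) (mulrC d).
Qed.

Lemma cpderiv_real alpha (phi : E -> R) :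
  cpderiv alpha (fun x => (phi x)%:C) = fun x => (pderiv alpha phi x)%:C.
Proof.
apply/funext => x; rewrite /cpderiv.
rewrite (_ : Im \o _ = cst 0); last by apply/funext.
by rewrite pderiv0.
Qed.

Lemma real_test_complex phi : real_test Omega phi ->
  complex_test (fun x => (phi x)%:C).
Proof.
move=> tphi; split=> //; apply: (real_test_sub tphi); first exact: smooth_cst.
by [].
Qed.

(** Real test functions are enough: they separate real and imaginary parts. *)
Lemma complex_weak_deriv_uniq alpha f g h :
  complex_weak_deriv alpha f g -> complex_weak_deriv alpha f h ->
  {ae mu, forall x : X, Omega x -> g x = h x}.
Proof.
move=> [_ gL fg] [_ hL fh].
have key phi : real_test Omega phi ->
    cintegral Omega (fun x => g x * (phi x)%:C) = cintegral Omega (fun x => h x * (phi x)%:C).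
  move=> /real_test_complex tphi; have := fg _ tphi; rewrite fh//.
  by move/(congr1 (fun y => (-1) ^+ morder alpha * y)); rewrite !mulrA -expr2 sqrr_sign !mul1r.
have aRe : annihilates Omega ((Re \o g) - (Re \o h)).
  apply: annihilates_sub => //; [exact: complex_L1loc_Re|exact: complex_L1loc_Re|].
  move=> phi /key /(congr1 Re) /=; under eq_Rintegral do rewrite ReM /= mulr0 subr0.
  by under [in RHS]eq_Rintegral do rewrite ReM /= mulr0 subr0.
have aIm : annihilates Omega ((Im \o g) - (Im \o h)).
  apply: annihilates_sub => //; [exact: complex_L1loc_Im|exact: complex_L1loc_Im|].
  move=> phi /key /(congr1 Im) /=; under eq_Rintegral do rewrite ImM /= mulr0 add0r.
  by under [in RHS]eq_Rintegral do rewrite ImM /= mulr0 add0r.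
move: (annihilates_ae0 Omega_open aRe) (annihilates_ae0 Omega_open aIm).
apply: filterS2 => x gr gi Ox; apply: complex_ext; apply/eqP; rewrite -subr_eq0; apply/eqP.
  exact: gr.
exact: gi.
Qed.

End complex_weak_derivative.

(** * Weak derivatives of functions with values u + vA *)

Section weak.
Context {R : realType} {n : nat} {A : R -> R}.
Hypotheses (A_fuzzy : fuzzy_number A) (A_asym : asymmetric A).
Local Notation E := 'rV[R]_n.+1.
Local Notation X := (lebesgue_space R n).
Local Notation mu := (@lebesgue_rV R n).
Local Notation C := R[i].
Local Notation m := ((mid_core A)%:C : C).
Implicit Types (Z W : CF A) (F G H Phi : E -> CF A) (alpha beta : 'I_n.+1 -> nat).
Variable Omega : set E.
Hypothesis Omega_open : open Omega.
Let mOmega := measurable_open Omega_open.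

Let uE u v : ucoord (psi A u v) = u. Proof. exact: ucoord_psi. Qed.
Let vE u v : vcoord (psi A u v) = v. Proof. exact: vcoord_psi. Qed.

Lemma psi_inj (u v z w : C) : psi A u v = psi A z w -> u = z /\ v = w.
Proof.
move=> eq_psi; split; first by rewrite -(uE u v) eq_psi uE.
by rewrite -(vE u v) eq_psi vE.
Qed.

Lemma cfscale_psi (c u v : C) : cfscale c (psi A u v) = psi A (c * u) (c * v).
Proof. by rewrite /cfscale uE vE. Qed.

(** First coordinate of the cross product of f + gA and z + wA, as an iterated
linear combination of two functions in the form of [cintegrable_lin], hence the
coefficient 1. *)
Definition cross_u (f g z w : E -> C) : E -> C := fun x =>
  1 * (f x * z x) + (- m ^+ 2) * (g x * w x).

(** Second coordinate of the same product, in the same form. *)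
Definition cross_v (f g z w : E -> C) : E -> C := fun x =>
  1 * (1 * (f x * w x) + 1 * (g x * z x)) + (2 * m) * (g x * w x).

Lemma cfintegral_cross (D : set E) F (W : E -> CF A) (f g z w : E -> C) :
  ucoord \o F = f -> vcoord \o F = g -> ucoord \o W = z -> vcoord \o W = w ->
  cfintegral D (fun x => cfcross (F x) (W x)) =
  psi A (cintegral D (cross_u f g z w)) (cintegral D (cross_v f g z w)).
Proof.
move=> <- <- <- <-; set FW := fun x => cfcross _ _.
have Eu : ucoord \o FW = cross_u (ucoord \o F) (vcoord \o F) (ucoord \o W) (vcoord \o W).
  apply/funext => x; apply: (etrans (uE _ _)); rewrite /cross_u /=.
  by move: (ucoord (F x)) (vcoord (F x)) (ucoord (W x)) (vcoord (W x)) m => *; ring.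
have Ev : vcoord \o FW = cross_v (ucoord \o F) (vcoord \o F) (ucoord \o W) (vcoord \o W).
  apply/funext => x; apply: (etrans (vE _ _)); rewrite /cross_v /=.
  by move: (ucoord (F x)) (vcoord (F x)) (ucoord (W x)) (vcoord (W x)) m => *; ring.
exact: (f_equal2 (fun a b => psi A (cintegral D a) (cintegral D b)) Eu Ev).
Qed.

Lemma test_complex Phi : test_function Omega Phi ->
  complex_test Omega (ucoord \o Phi) /\ complex_test Omega (vcoord \o Phi).
Proof.
move=> [[[su1 su2] [sv1 sv2]] cK KO].
have sub f : smooth f -> (forall x, Phi x = cfzero A -> f x = 0) -> real_test Omega f.
  move=> sf f0; have fs : tsupp f `<=` closure [set x | Phi x <> cfzero A].
    by apply: closure_subset => x /= fx; apply: contra_not fx; exact: f0.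
  split; [exact: sf| |exact: subset_trans fs KO].
  exact: subclosed_compact (@closed_closure _ _) cK fs.
by split; split; apply: sub => // x /= ->; rewrite ?uE ?vE.
Qed.

(** The cross product with z + 0A multiplies both coordinates by z. *)
Lemma complex_test_function z : complex_test Omega z ->
  test_function Omega (fun x => psi A (z x) 0).
Proof.
move=> [[sr cr rO] [si ci iO]]; set Phi := fun x => _.
have Eu : ucoord \o Phi = z by apply/funext => x; exact: uE.
have Ev : vcoord \o Phi = fun=> 0 by apply/funext => x; exact: vE.
have supp : closure [set x | Phi x <> cfzero A] `<=`
    tsupp (@complex.Re R \o z) `|` tsupp (@complex.Im R \o z).
  rewrite closureE; apply: smallest_sub.
    by apply: closedU; exact: closed_closure.
  move=> x /= Px; apply: contrapT => /not_orP[/tsupp0 /= zr /tsupp0 /= zi].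
  by apply: Px; rewrite /Phi /cfzero; congr psi; exact: complex_ext.
split.
- by rewrite /cfsmooth Eu Ev; split; split=> //; exact: smooth_cst.
- by apply: subclosed_compact (compactU cr ci) supp; exact: closed_closure.
- by move=> x /supp[]; [exact: rO|exact: iO].
Qed.

Lemma ucoord_cfpderiv alpha Phi : ucoord \o cfpderiv alpha Phi = cpderiv alpha (ucoord \o Phi).
Proof. by apply/funext => x; exact: uE. Qed.

Lemma vcoord_cfpderiv alpha Phi : vcoord \o cfpderiv alpha Phi = cpderiv alpha (vcoord \o Phi).
Proof. by apply/funext => x; exact: vE. Qed.

(** From left to right, test against z + 0A; from right to left, expand the cross
product and use linearity of the integral. *)
Lemma weak_derivE alpha F G : weak_deriv Omega alpha F G <->
  complex_weak_deriv Omega alpha (ucoord \o F) (ucoord \o G) /\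
  complex_weak_deriv Omega alpha (vcoord \o F) (vcoord \o G).
Proof.
split=> [[FL GL FG]|[[FuL GuL FGu] [FvL GvL FGv]]].
  have key z : complex_test Omega z ->
      cintegral Omega (fun x => ucoord (F x) * cpderiv alpha z x) =
      (-1) ^+ morder alpha * cintegral Omega (fun x => ucoord (G x) * z x) /\
      cintegral Omega (fun x => vcoord (F x) * cpderiv alpha z x) =
      (-1) ^+ morder alpha * cintegral Omega (fun x => vcoord (G x) * z x).
    move=> tz; pose Phi x := psi A (z x) 0.
    have Eu : ucoord \o Phi = z by apply/funext => x; exact: uE.
    have Ev : vcoord \o Phi = fun=> 0 by apply/funext => x; exact: vE.
    have D0 : cpderiv alpha (fun=> 0 : C) = (fun=> 0 : C) :> (E -> C).
      by rewrite (cpderiv_real alpha (fun=> 0)) pderiv0.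
    have Du := ucoord_cfpderiv alpha Phi; have Dv := vcoord_cfpderiv alpha Phi.
    rewrite Eu in Du; rewrite Ev D0 in Dv.
    have E1 := cfintegral_cross Omega (erefl (ucoord \o F)) (erefl (vcoord \o F)) Du Dv.
    have E2 := cfintegral_cross Omega (erefl (ucoord \o G)) (erefl (vcoord \o G)) Eu Ev.
    have := etrans (esym E1) (etrans (FG _ (complex_test_function tz))
      (etrans (congr1 (cfscale _) E2) (cfscale_psi _ _ _))).
    move=> /psi_inj.
    have cu (f g y : E -> C) : cross_u f g y (fun=> 0) = fun x => f x * y x.
      by apply/funext => x; rewrite /cross_u !mulr0 addr0 mul1r.
    have cv (f g y : E -> C) : cross_v f g y (fun=> 0) = fun x => g x * y x.
      by apply/funext => x; rewrite /cross_v !mulr0 addr0 add0r !mul1r.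
    by rewrite !cu !cv.
  split; split.
  - by move=> K cK KO; exact: (FL K cK KO).1.
  - by move=> K cK KO; exact: (GL K cK KO).1.
  - by move=> z /key[].
  - by move=> K cK KO; exact: (FL K cK KO).2.
  - by move=> K cK KO; exact: (GL K cK KO).2.
  - by move=> z /key[].
split.
- by move=> K cK KO; split; [exact: FuL|exact: FvL].
- by move=> K cK KO; split; [exact: GuL|exact: GvL].
move=> Phi tPhi; have [tz tw] := test_complex tPhi.
have tDz := complex_test_pderiv alpha tz; have tDw := complex_test_pderiv alpha tw.
apply: (etrans (cfintegral_cross Omega (erefl (ucoord \o F)) (erefl (vcoord \o F))
  (ucoord_cfpderiv alpha Phi) (vcoord_cfpderiv alpha Phi))).
apply: (etrans _ (esym (etrans (congr1 (cfscale _) (cfintegral_cross Omega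
  (erefl (ucoord \o G)) (erefl (vcoord \o G)) (erefl (ucoord \o Phi)) (erefl (vcoord \o Phi))))
  (cfscale_psi _ _ _)))).
have int_u (f g z w : E -> C) : complex_L1loc Omega f -> complex_L1loc Omega g ->
    complex_test Omega z -> complex_test Omega w ->
    cintegral Omega (cross_u f g z w) =
    1 * cintegral Omega (fun x => f x * z x) + (- m ^+ 2) * cintegral Omega (fun x => g x * w x).
  move=> fL gL t1 t2.
  have fz := cintegrable_mul_test Omega_open fL t1.
  have gw := cintegrable_mul_test Omega_open gL t2.
  exact: (cintegrable_lin mOmega 1 (- m ^+ 2) fz gw).2.
have int_v (f g z w : E -> C) : complex_L1loc Omega f -> complex_L1loc Omega g ->
    complex_test Omega z -> complex_test Omega w ->
    cintegral Omega (cross_v f g z w) =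
    1 * (1 * cintegral Omega (fun x => f x * w x) + 1 * cintegral Omega (fun x => g x * z x))
    + (2 * m) * cintegral Omega (fun x => g x * w x).
  move=> fL gL t1 t2.
  have fw := cintegrable_mul_test Omega_open fL t2.
  have gz := cintegrable_mul_test Omega_open gL t1.
  have gw := cintegrable_mul_test Omega_open gL t2.
  have [i1 e1] := cintegrable_lin mOmega 1 1 fw gz.
  by rewrite -e1; exact: (cintegrable_lin mOmega 1 (2 * m) i1 gw).2.
have scal_u : cintegral Omega (cross_u (ucoord \o F) (vcoord \o F)
      (cpderiv alpha (ucoord \o Phi)) (cpderiv alpha (vcoord \o Phi))) =
    (-1) ^+ morder alpha * cintegral Omega (cross_u (ucoord \o G) (vcoord \o G)
      (ucoord \o Phi) (vcoord \o Phi)).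
  apply: (etrans (int_u _ _ _ _ FuL FvL tDz tDw)).
  apply: (etrans _ (esym (congr1 _ (int_u _ _ _ _ GuL GvL tz tw)))).
  apply: (etrans (f_equal2 (fun a b => 1 * a + (- m ^+ 2) * b) (FGu _ tz) (FGv _ tw))).
  by rewrite !mul1r mulrDr (mulrCA (- m ^+ 2)).
have scal_v : cintegral Omega (cross_v (ucoord \o F) (vcoord \o F)
      (cpderiv alpha (ucoord \o Phi)) (cpderiv alpha (vcoord \o Phi))) =
    (-1) ^+ morder alpha * cintegral Omega (cross_v (ucoord \o G) (vcoord \o G)
      (ucoord \o Phi) (vcoord \o Phi)).
  apply: (etrans (int_v _ _ _ _ FuL FvL tDz tDw)).
  apply: (etrans _ (esym (congr1 _ (int_v _ _ _ _ GuL GvL tz tw)))).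
  apply: (etrans (f_equal2 (fun a b => 1 * a + (2 * m) * b)
    (f_equal2 (fun a b => 1 * a + 1 * b) (FGu _ tw) (FGv _ tz)) (FGv _ tw))).
  by rewrite !mul1r !mulrDr (mulrCA (2 * m)).
exact: (f_equal2 (psi A) scal_u scal_v).
Qed.

Lemma weak_deriv_uniq alpha F G H :
  weak_deriv Omega alpha F G -> weak_deriv Omega alpha F H -> cfae_eq Omega G H.
Proof.
move=> /weak_derivE[Gu Gv] /weak_derivE[Hu Hv].
move: (complex_weak_deriv_uniq Omega_open Gu Hu) (complex_weak_deriv_uniq Omega_open Gv Hv).
apply: filterS2 => x u v Ox; rewrite -(psi_coord (G x)) -(psi_coord (H x)).
exact: (f_equal2 (psi A) (u Ox) (v Ox)).
Qed.

Lemma weak_deriv_comp alpha beta F Fa H :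
  weak_deriv Omega alpha F Fa -> weak_deriv Omega (madd alpha beta) F H ->
  weak_deriv Omega beta Fa H.
Proof.
move=> /weak_derivE[Fu Fv] /weak_derivE[Hu Hv]; apply/weak_derivE; split.
  exact: complex_weak_deriv_comp Fu Hu.
exact: complex_weak_deriv_comp Fv Hv.
Qed.

Lemma weak_deriv_lin alpha (c d : C) F G Fa Ga :
  weak_deriv Omega alpha F Fa -> weak_deriv Omega alpha G Ga ->
  weak_deriv Omega alpha (fun x => cfadd (cfscale c (F x)) (cfscale d (G x)))
    (fun x => cfadd (cfscale c (Fa x)) (cfscale d (Ga x))).
Proof.
move=> /weak_derivE[Fu Fv] /weak_derivE[Gu Gv]; apply/weak_derivE.
have Eu F1 F2 : ucoord \o (fun x : E => cfadd (cfscale c (F1 x)) (cfscale d (F2 x))) =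
    fun x => c * (ucoord \o F1) x + d * (ucoord \o F2) x.
  by apply/funext => x; apply: (etrans (uE _ _)); exact: (f_equal2 +%R (uE _ _) (uE _ _)).
have Ev F1 F2 : vcoord \o (fun x : E => cfadd (cfscale c (F1 x)) (cfscale d (F2 x))) =
    fun x => c * (vcoord \o F1) x + d * (vcoord \o F2) x.
  by apply/funext => x; apply: (etrans (vE _ _)); exact: (f_equal2 +%R (vE _ _) (vE _ _)).
have conv f f' g g' : f = f' -> g = g' ->
    complex_weak_deriv Omega alpha f' g' -> complex_weak_deriv Omega alpha f g.
  by move=> -> ->.
split.
  exact: conv (Eu F G) (Eu Fa Ga) (complex_weak_deriv_lin Omega_open c d Fu Gu).
exact: conv (Ev F G) (Ev Fa Ga) (complex_weak_deriv_lin Omega_open c d Fv Gv).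
Qed.

End weak.

(** * Composition and linearity of weak derivatives *)

Theorem theorem4p9 (R : realType) (A : R -> R)
    (A_fuzzy : fuzzy_number A) (A_asym : asymmetric A)
    (n : nat) (Omega : set 'rV[R]_n.+1) (Omega_open : open Omega)
    (k : nat) (k_gt0 : (0 < k)%N) (p : R) (p_ge1 : 1 <= p)
    (F G : 'rV[R]_n.+1 -> CF A)
    (FW : sobolev k p Omega F) (GW : sobolev k p Omega G) :
  (forall alpha beta : 'I_n.+1 -> nat,
    (morder alpha + morder beta <= k)%N ->
    forall Fa Fb : 'rV[R]_n.+1 -> CF A,
      weak_deriv Omega alpha F Fa -> weak_deriv Omega beta F Fb ->
      [/\ exists P, weak_deriv Omega beta Fa P,
          exists Q, weak_deriv Omega alpha Fb Q,
          exists H, weak_deriv Omega (madd alpha beta) F H &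
          forall P Q H : 'rV[R]_n.+1 -> CF A,
            weak_deriv Omega beta Fa P ->
            weak_deriv Omega alpha Fb Q ->
            weak_deriv Omega (madd alpha beta) F H ->
            cfae_eq Omega P Q /\ cfae_eq Omega Q H])
  /\
  (forall alpha : 'I_n.+1 -> nat, (morder alpha <= k)%N ->
    forall (c1 c2 : R[i]) (Fa Ga : 'rV[R]_n.+1 -> CF A),
      weak_deriv Omega alpha F Fa -> weak_deriv Omega alpha G Ga ->
      let FG := fun x => cfadd (cfscale c1 (F x)) (cfscale c2 (G x)) in
      (exists H, weak_deriv Omega alpha FG H) /\
      forall H : 'rV[R]_n.+1 -> CF A,
        weak_deriv Omega alpha FG H ->
        cfae_eq Omega H
          (fun x => cfadd (cfscale c1 (Fa x)) (cfscale c2 (Ga x)))).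
Proof.
split=> [alpha beta abk Fa Fb FFa FFb|alpha _ c1 c2 Fa Ga FFa GGa FG].
  have maddC : madd alpha beta = madd beta alpha.
    by apply/funext => i; rewrite /madd addnC.
  have [|H0 _ FH0] := FW.2 (madd alpha beta); first by rewrite morder_madd.
  have FaH H : weak_deriv Omega (madd alpha beta) F H -> weak_deriv Omega beta Fa H.
    exact: weak_deriv_comp.
  have FbH H : weak_deriv Omega (madd alpha beta) F H -> weak_deriv Omega alpha Fb H.
    by rewrite maddC; exact: weak_deriv_comp.
  split; [by exists H0; exact: FaH|by exists H0; exact: FbH|by exists H0|].
  move=> P Q H FaP FbQ FH; have QH : cfae_eq Omega Q H.
    exact: (weak_deriv_uniq A_fuzzy A_asym Omega_open FbQ (FbH _ FH)).
  split=> //; have HP : cfae_eq Omega P H.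
    exact: (weak_deriv_uniq A_fuzzy A_asym Omega_open FaP (FaH _ FH)).
  by move: HP QH; apply: filterS2 => x PH QH Ox; rewrite PH// QH.
have FGab := weak_deriv_lin A_fuzzy A_asym Omega_open c1 c2 FFa GGa.
split; first by eexists; exact: FGab.
by move=> H FGH; exact: (weak_deriv_uniq A_fuzzy A_asym Omega_open FGH FGab).
Qed.
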